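(* Every (finite-dimensional) ANR that has the closed $0$-stitched disks property has also the piecewise disjoint arc-disk property (P-DADP).
   Context: All spaces are finite-dimensional. ANRs are locally contractible, locally compact, separable metric spaces. $I=[0,1]$; $D^2$ is the disk; maps are continuous. A map $f':Z\to X$ ($Z$ compact) is an $\epsilon$-approximation of $f:Z\to X$ if $\rho(f(z),f'(z))<\epsilon$ for all $z$, $\rho$ being the metric of $X$. An $\epsilon$-homotopy is a homotopy $H:Z\times[0,1]\to X$ with $\mathrm{diam}\,H(\{z\}\times[0,1])<\epsilon$ for all $z$. An infinite 1-skeleton of $D^2$ is a set $(K^\infty)^{(1)}=\bigcup_i K_i^{(1)}$, where $\{K_i\}$ is a sequence of triangulations of $D^2$ with $K_1<K_2<\cdots$ (each refining the previous one) and $\mathrm{mesh}(K_i)\to 0$. Closed $0$-stitched disks property: any two maps $f,g:D^2\to X$ can be approximated arbitrarily closely by maps $f',g':D^2\to X$ for which there are closed $0$-dimensional (possibly empty) sets $A,B$ contained in the interior of $D^2$ and infinite 1-skeleta $(K_1^\infty)^{(1)},(K_2^\infty)^{(1)}$ of $D^2$ such that $f'(D^2-A)\cap g'(D^2-B)=\emptyset$, $A\cap (K_1^\infty)^{(1)}=\emptyset$, $B\cap (K_2^\infty)^{(1)}=\emptyset$, and $f'|_{(K_1^\infty)^{(1)}}\cup g'|_{(K_2^\infty)^{(1)}}$ is 1-1 (as a map on the disjoint union of the two 1-skeleta). For a cell complex $T$ of $D^2$ (a finite cell decomposition of $D^2$ into closed cells), $T^{(1)}$ is its 1-skeleton and $T^{(2)}$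 its collection of 2-cells. P-DADP: for every $f:D^2\to X$, $\alpha:I\to X$ and $\epsilon>0$ there are a cell complex $T$ of $D^2$ and $\epsilon$-approximations $f':D^2\to X$ of $f$ and $\alpha':I\to X-f'(T^{(1)})$ of $\alpha$ such that for each $\sigma\in T^{(2)}$ there is an $\epsilon$-homotopy $H_\sigma:I\times[0,1]\to X-f'(T^{(1)})$ from $\alpha'$ to a map $\alpha'':I\to X-f'(\sigma)$ ($\alpha''$ may depend on $\sigma$). *)

(* Defs.v *)
From HB Require Import structures.
From mathcomp Require Import all_boot all_order all_algebra.
From mathcomp Require Import all_classical all_reals all_analysis.

Set Implicit Arguments.
Unset Strict Implicit.
Unset Printing Implicit Defensive.

Import Order.TTheory GRing.Theory Num.Theory.
Import numFieldNormedType.Exports.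

Local Open Scope classical_set_scope.
Local Open Scope card_scope.
Local Open Scope ring_scope.

(* A map with domain a subset Z of an ambient space is represented by a total
   function together with {within Z, continuous _}; its values outside Z are
   irrelevant. *)

Section Spaces.
Context {R : realType}.

Definition I01 : set R := `[0, 1]%classic.

Definition homeomorphism (S T : topologicalType) (A : set S) (B : set T)
    (f : S -> T) : Prop :=
  {within A, continuous f} /\ set_bij A B f /\
  exists g : T -> S,
    {within B, continuous g} /\ (forall x, A x -> g (f x) = x).

Definition homotopy_in (S T : topologicalType) (Z : set S) (U : set T)
    (H : S * R -> T) (f g : S -> T) : Prop :=
  {within Z `*` I01, continuous H} /\
  (forall z t, Z z -> I01 t -> U (H (z, t))) /\
  (forall z, Z z -> H (z, 0) = f z /\ H (z, 1) = g z).

Definition contractible_in (T : topologicalType) (V U : set T) : Prop :=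
  exists (c : T) (H : T * R -> T), homotopy_in V U H id (cst c).

Definition locally_contractible (T : topologicalType) : Prop :=
  forall (x : T) (U : set T), nbhs x U ->
    exists V : set T, nbhs x V /\ V `<=` U /\ contractible_in V U.

Definition separable (T : topologicalType) : Prop :=
  exists D : set T, countable D /\ dense D.

Definition ANR (X : metricType R) : Prop :=
  locally_contractible X /\ locally_compact [set: X] /\ separable X.

(* Lebesgue covering dimension of the subspace A; relatively open subsets of A
   are represented by open subsets of T, and the order of the refinement is
   only counted at points of A. *)
Definition covering_dim_le (T : topologicalType) (A : set T) (n : nat) : Prop :=
  forall U : set (set T),
    (forall O, U O -> open O) -> A `<=` \bigcup_(O in U) O ->
    exists V : set (set T),
      (forall W, V W -> open W /\ exists2 O, U O & W `<=` O) /\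
      A `<=` \bigcup_(W in V) W /\
      (forall x, A x -> [set W | V W /\ W x] #<= `I_n.+1).

Definition finite_dimensional (T : topologicalType) : Prop :=
  exists n, covering_dim_le [set: T] n.

Definition diam (T : Type) (dist : T -> T -> R) (A : set T) : \bar R :=
  ereal_sup [set r | exists x y, A x /\ A y /\ r = (dist x y)%:E].

Definition eps_approx (S : Type) (X : metricType R) (Z : set S) (eps : R)
    (f f' : S -> X) : Prop :=
  forall z, Z z -> mdist (f z) (f' z) < eps.

Definition eps_tracks (S : Type) (X : metricType R) (Z : set S) (eps : R)
    (H : S * R -> X) : Prop :=
  forall z, Z z ->
    (diam (@mdist R X) (H @` ([set z] `*` I01)) < eps%:E)%E.

(* The library norm on row vectors is the sup norm. *)
Definition enorm n (x : 'rV[R]_n) : R := Num.sqrt (\sum_i x ord0 i ^+ 2).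
Definition eucl_dist n (x y : 'rV[R]_n) : R := enorm (x - y).

Definition eball n : set 'rV[R]_n := [set x | enorm x <= 1].
Definition eball_int n : set 'rV[R]_n := [set x | enorm x < 1].
Definition esphere n : set 'rV[R]_n := [set x | enorm x = 1].

End Spaces.

Arguments eball {R} n _.
Arguments eball_int {R} n _.
Arguments esphere {R} n _.

Definition disk {R : realType} : set 'rV[R]_2 := eball 2.

Section Complexes.
Context {R : realType}.

(* The face spanned by s in the standard simplex with vertex set 'I_n. *)
Definition std_face n (s : {set 'I_n}) : set 'rV[R]_n :=
  [set x | (forall i, 0 <= x ord0 i) /\ \sum_i x ord0 i = 1 /\
           (forall i, i \notin s -> x ord0 i = 0)].

(* A triangulation of the disk: an abstract finite simplicial complex and a
   homeomorphism from its geometric realization onto the disk. *)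
Record triangulation := Triangulation {
  tri_n : nat;
  tri_simplices : {set {set 'I_tri_n}};
  tri_map : 'rV[R]_tri_n -> 'rV[R]_2;
  tri_nonempty : finset.set0 \notin tri_simplices;
  tri_faces : forall s t : {set 'I_tri_n},
    s \in tri_simplices -> t \subset s -> t != finset.set0 -> t \in tri_simplices;
  tri_homeo : homeomorphism
    (\bigcup_(s in [set` tri_simplices]) std_face s) disk tri_map
}.

Definition tri_cell (K : triangulation) (s : {set 'I_(tri_n K)}) :
  set 'rV[R]_2 := @tri_map K @` std_face s.

Definition tri_skel1 (K : triangulation) : set 'rV[R]_2 :=
  \bigcup_(s in [set s | s \in tri_simplices K /\ (#|s| <= 2)%N]) tri_cell s.

Definition mesh (K : triangulation) : \bar R :=
  ereal_sup [set diam (@eucl_dist R 2) (tri_cell s) | s in [set` tri_simplices K]].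

Definition refines (L K : triangulation) : Prop :=
  (forall t, t \in tri_simplices L ->
     exists2 s, s \in tri_simplices K & tri_cell t `<=` tri_cell s) /\
  (forall s, s \in tri_simplices K ->
     tri_cell s = \bigcup_(t in [set t | t \in tri_simplices L /\
                                  tri_cell t `<=` tri_cell s]) tri_cell t).

Definition infinite_skel1 (S : set 'rV[R]_2) : Prop :=
  exists K : nat -> triangulation,
    (forall i, refines (K i.+1) (K i)) /\
    (mesh (K i) @[i --> \oo] --> 0%E) /\
    S = \bigcup_i tri_skel1 (K i).

(* A finite decomposition of the disk into closed cells, each of them the
   homeomorphic image of a Euclidean ball of dimension 0, 1 or 2. *)
Record cell_complex := CellComplex {
  cc_n : nat;
  cc_dim : 'I_cc_n -> 'I_3;
  cc_map : forall i, 'rV[R]_(cc_dim i) -> 'rV[R]_2;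
  cc_cell := fun i => @cc_map i @` eball (cc_dim i);
  cc_open := fun i => @cc_map i @` eball_int (cc_dim i);
  cc_bd := fun i => @cc_map i @` esphere (cc_dim i);
  cc_homeo : forall i,
    homeomorphism (eball (cc_dim i)) (cc_cell i) (@cc_map i);
  cc_cover : \bigcup_i cc_cell i = disk;
  cc_disjoint : forall i j, i != j -> cc_open i `&` cc_open j = set0;
  cc_boundary : forall i,
    cc_bd i = \bigcup_(j in [set j | (cc_dim j < cc_dim i)%N /\
                              cc_cell j `<=` cc_bd i]) cc_cell j
}.

Definition cc_skel1 (T : cell_complex) : set 'rV[R]_2 :=
  \bigcup_(i in [set i | (cc_dim i <= 1)%N]) @cc_cell T i.

Definition two_cells (T : cell_complex) : set (set 'rV[R]_2) :=
  [set @cc_cell T i | i in [set i | cc_dim i = 2%N :> nat]].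

End Complexes.

Section Properties.
Context {R : realType} (X : metricType R).

Definition closed_0_stitched_disks : Prop :=
  forall f g : 'rV[R]_2 -> X,
  {within disk, continuous f} -> {within disk, continuous g} ->
  forall eps : R, 0 < eps ->
  exists (f' g' : 'rV[R]_2 -> X) (A B S1 S2 : set 'rV[R]_2),
    {within disk, continuous f'} /\ {within disk, continuous g'} /\
    eps_approx disk eps f f' /\ eps_approx disk eps g g' /\
    closed A /\ covering_dim_le A 0 /\ A `<=` interior disk /\
    closed B /\ covering_dim_le B 0 /\ B `<=` interior disk /\
    infinite_skel1 S1 /\ infinite_skel1 S2 /\
    f' @` (disk `\` A) `&` g' @` (disk `\` B) = set0 /\
    A `&` S1 = set0 /\ B `&` S2 = set0 /\
    set_inj
      [set u : 'rV[R]_2 + 'rV[R]_2 |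
         match u with inl x => S1 x | inr y => S2 y end]
      (fun u => match u with inl x => f' x | inr y => g' y end).

Definition P_DADP : Prop :=
  forall (f : 'rV[R]_2 -> X) (alpha : R -> X) (eps : R),
  {within disk, continuous f} -> {within I01, continuous alpha} -> 0 < eps ->
  exists (T : @cell_complex R) (f' : 'rV[R]_2 -> X) (alpha' : R -> X),
    {within disk, continuous f'} /\ {within I01, continuous alpha'} /\
    eps_approx disk eps f f' /\ eps_approx I01 eps alpha alpha' /\
    alpha' @` I01 `<=` ~` (f' @` cc_skel1 T) /\
    forall sigma, two_cells T sigma ->
      exists (H : R * R -> X) (alpha'' : R -> X),
        homotopy_in I01 (~` (f' @` cc_skel1 T)) H alpha' alpha'' /\
        eps_tracks I01 eps H /\
        alpha'' @` I01 `<=` ~` (f' @` sigma).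

End Properties.

(* Main.v *)
Require Import Defs.
From mathcomp Require Import all_boot all_order all_algebra.
From mathcomp Require Import all_classical all_reals all_analysis.
From mathcomp Require Import ring lra.

(** Put g = alpha o (first coordinate, clipped to [0, 1]) and stitch f and g.
    The set B keeps away from the upper right arc of the unit circle, so near
    that arc the 1-skeleta of the second disk contain two disjoint paths J1, J2
    that are joined by a straight-line homotopy missing B, and
    alpha' = g' o J1 approximates alpha.  The images of J1 and J2 under g' are
    disjoint because g' is injective on the skeleta, hence they are at positive
    distance; if the triangulation of the first disk is so fine that every
    f'(sigma) has smaller diameter, each f'(sigma) misses one of them, and
    alpha'' is that one.  The homotopy misses f' of the 1-skeleton, which avoids
    A.  To use a triangulation of the disk as a cell complex one needs that its
    simplices have dimension at most 2, i.e. that a tetrahedron does not embed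
    in the plane; this is the Borsuk-Ulam theorem for an octahedron. *)

Set Implicit Arguments.
Unset Strict Implicit.
Unset Printing Implicit Defensive.

Import Order.TTheory GRing.Theory Num.Theory.
Import numFieldNormedType.Exports.

Local Open Scope classical_set_scope.
Local Open Scope ring_scope.

(** * Continuity on subsets and compactness *)

Section Topology.
Context {R : realType}.

Lemma within_comp (S T U : topologicalType) (A : set S) (B : set T)
    (f : S -> T) (g : T -> U) :
  {within A, continuous f} -> {within B, continuous g} ->
  (forall x, A x -> B (f x)) -> {within A, continuous (g \o f)}.
Proof.
move=> /subspace_continuousP cf /subspace_continuousP cg AB.
apply/subspace_continuousP => x Ax.
move=> W /(cg _ (AB _ Ax)) BW.
have H : nbhs x [set y | A y -> B (f y) -> W (g (f y))] by exact: cf _ Ax _ BW.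
apply: (filterS _ H) => y /= h Ay; exact: (h Ay (AB _ Ay)).
Qed.

Lemma continuous_pair (S T U : topologicalType) (f : S -> T) (g : S -> U) :
  continuous f -> continuous g -> continuous (fun x => (f x, g x)).
Proof. by move=> cf cg x; exact: (cvg_pair (cf x) (cg x)). Qed.

(** Each point of [K] has a ball of some radius [e] missing [C]; then [e / 2] serves all points
    within [e / 2] of it, and the near-covering form of compactness makes the radius uniform. *)
Lemma compact_gap (S : pseudoMetricType R) (K C : set S) :
  compact K -> closed C -> K `&` C = set0 ->
  exists2 d : R, 0 < d & forall x y, K x -> C y -> ~ ball x d y.
Proof.
move=> /compact_near_coveringP cK cC KC.
have := cK R (0^'+) (fun d x => forall y, C y -> ~ ball x d y) _.
case.
- move=> x Kx.
  have : nbhs x (~` C).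
    apply: open_nbhs_nbhs; split; first exact: closed_openC.
    by move=> Cx; rewrite -[False]/(set0 x) -KC.
  move/nbhs_ballP => [e /= e0 xe].
  exists (ball x (e / 2), [set d | d < e / 2]).
    split; first by apply: nbhsx_ballx; rewrite divr_gt0.
    by near=> d => /=; near: d; apply: nbhs_right_lt; rewrite divr_gt0.
  move=> [z d] /= [xz de] y Cy zy; apply: (xe y) => //.
  by rewrite [e]splitr; apply: (ball_triangle xz); apply: le_ball zy; exact: ltW.
- move=> d /= d0 H.
  (* The filter [0^'+] gives the property for all small positive radii, from which one is picked. *)
  exists (d / 2); first by rewrite divr_gt0.
  move=> x y Kx Cy; apply: (H (d / 2)) => //; last by rewrite divr_gt0.
  by rewrite /ball_/= sub0r normrN gtr0_norm ?divr_gt0// gtr_pMr// invf_lt1 ?ltr1n.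
Unshelve. all: by end_near. Qed.

(** Heine-Cantor by the same covering argument: two nearby points are both compared with the centre
    of the covering ball. *)
Lemma compact_unif_continuous (S T : pseudoMetricType R) (K : set S) (f : S -> T) :
  compact K -> {within K, continuous f} -> forall e : R, 0 < e ->
  exists2 d : R, 0 < d &
    forall x y, K x -> K y -> ball x d y -> ball (f x) e (f y).
Proof.
move=> /compact_near_coveringP cK /subspace_continuousP cf e e0.
have := cK R (0^'+) (fun d x => forall y, K x -> K y -> ball x d y ->
  ball (f x) e (f y)) _.
case.
- move=> x Kx.
  have : nbhs (f x) (ball (f x) (e / 2)) by apply: nbhsx_ballx; rewrite divr_gt0.
  move/(cf x Kx); rewrite /= nbhs_simpl /= => /nbhs_ballP[r /= r0 xr].
  exists (ball x (r / 2), [set d | d < r / 2]).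
    split; first by apply: nbhsx_ballx; rewrite divr_gt0.
    by near=> d => /=; near: d; apply: nbhs_right_lt; rewrite divr_gt0.
  move=> [z d] /= [xz dr] y Kz Ky zy; rewrite [e]splitr.
  apply: (@ball_triangle _ _ (f x)).
    apply: ball_sym; apply: xr => //; apply: le_ball xz.
    by rewrite ler_pdivrMr// ler_peMr ?ler1n// ltW.
  apply: xr => //; rewrite [r]splitr; apply: (ball_triangle xz).
  by apply: le_ball zy; exact: ltW.
- move=> d /= d0 H.
  exists (d / 2); first by rewrite divr_gt0.
  move=> x y Kx Ky; apply: (H (d / 2)) => //; last by rewrite divr_gt0.
  by rewrite /ball_/= sub0r normrN gtr0_norm ?divr_gt0// gtr_pMr// invf_lt1 ?ltr1n.
Unshelve. all: by end_near. Qed.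

Lemma compact_I01 : compact (@I01 R).
Proof. exact: segment_compact. Qed.

Lemma I01P (t : R) : I01 t <-> 0 <= t <= 1.
Proof. by rewrite /I01 /= in_itv. Qed.

End Topology.

(** * Rotation angles between plane vectors *)

Section PlaneRotation.
Context {R : realType}.
Implicit Types u v w : 'rV[R]_2.

Let i1 : 'I_2 := @Ordinal 2 1 isT.

Definition dot2 u v := u 0 0 * v 0 0 + u 0 i1 * v 0 i1.
Definition det2 u v := u 0 0 * v 0 i1 - u 0 i1 * v 0 0.
(** This is the signed angle from [u] to [v] as long as [dot2 u v] is positive, when it lies in
    (-pi/2, pi/2). *)
Definition ang2 u v := atan (det2 u v / dot2 u v).

(** A relation instead of an argument function: it needs no branch cut, and angles add up along a
    chain of vectors. *)
Definition turned (a : R) u v := exists2 k : R, 0 < k &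
  v 0 0 = k * (cos a * u 0 0 - sin a * u 0 i1) /\
  v 0 i1 = k * (sin a * u 0 0 + cos a * u 0 i1).

Lemma row2P u v : u 0 0 = v 0 0 -> u 0 i1 = v 0 i1 -> u = v.
Proof.
move=> e0 e1; apply/rowP => i.
have /orP[/eqP->|/eqP->] // : (i == 0) || (i == i1) by case: i => -[|[|]].
Qed.

Lemma sin_atan (x : R) : sin (atan x) = x / Num.sqrt (1 + x ^+ 2).
Proof.
have c0 : cos (atan x) != 0.
  by rewrite cos_atan invr_eq0 sqrtr_eq0 -ltNge ltr_pwDl// sqr_ge0.
by rewrite -cos_atan -{2}(atanK x) /tan divfK.
Qed.

(** The identity behind it: [dot2 u v] times [u] plus [det2 u v] times the quarter turn of [u]
    equals [dot2 u u] times [v]. The cosine and sine of an arctangent contribute the square root in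
    the factor. *)
Lemma turned_ang2 u v : 0 < dot2 u v -> turned (ang2 u v) u v.
Proof.
move=> d0.
have n0 : 0 < dot2 u u.
  rewrite lt_neqAle /dot2 -!expr2 addr_ge0 ?sqr_ge0 // andbT eq_sym.
  rewrite paddr_eq0 ?sqr_ge0 // !sqrf_eq0; apply/negP => /andP[/eqP a /eqP b].
  by move: d0; rewrite /dot2 a b !mul0r addr0 ltxx.
set x := det2 u v / dot2 u v.
have s0 : 0 < Num.sqrt (1 + x ^+ 2) by rewrite sqrtr_gt0 ltr_pwDl// sqr_ge0.
exists (dot2 u v * Num.sqrt (1 + x ^+ 2) / dot2 u u).
  by rewrite divr_gt0// mulr_gt0.
rewrite /ang2 sin_atan cos_atan -/x.
have xd : x * dot2 u v = det2 u v by rewrite /x mulfVK// gt_eqF.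
move: (s0) (n0); move: (Num.sqrt _) => s s1 n1.
split.
  transitivity ((dot2 u v * u 0 0 - (x * dot2 u v) * u 0 i1) / dot2 u u).
    rewrite xd; apply: (@mulIf _ (dot2 u u)); first by rewrite gt_eqF.
    by rewrite mulfVK ?gt_eqF// /dot2 /det2; ring.
  by field; rewrite !gt_eqF.
transitivity ((dot2 u v * u 0 i1 + (x * dot2 u v) * u 0 0) / dot2 u u).
  rewrite xd; apply: (@mulIf _ (dot2 u u)); first by rewrite gt_eqF.
  by rewrite mulfVK ?gt_eqF// /dot2 /det2; ring.
by field; rewrite !gt_eqF.
Qed.

Lemma turned0 u : turned 0 u u.
Proof. by exists 1; rewrite ?cos0 ?sin0; [|split; ring]. Qed.

Lemma turned_trans a b u v w :
  turned a u v -> turned b v w -> turned (a + b) u w.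
Proof.
move=> [k k0 [v0 v1]] [l l0 [w0 w1]]; exists (l * k); first exact: mulr_gt0.
by rewrite sinD cosD w0 w1 v0 v1; split; ring.
Qed.

(** Both [v] and [- v] are positive multiples of one vector, so a positive multiple of that vector
    is 0. *)
Lemma turned_opp a u v : turned a u v -> turned a u (- v) -> v = 0.
Proof.
move=> [k k0 [v0 v1]] [l l0 []]; rewrite !mxE.
set p := cos a * u 0 0 - sin a * u 0 i1 in v0 *.
set q := sin a * u 0 0 + cos a * u 0 i1 in v1 * => w0 w1.
have p0 : (k + l) * p = 0 by rewrite mulrDl -v0 -w0 addrN.
have q0 : (k + l) * q = 0 by rewrite mulrDl -v1 -w1 addrN.
have /eqP kl0 : k + l != 0 by rewrite gt_eqF// addr_gt0.
apply: row2P; rewrite mxE ?v0 ?v1; apply/eqP.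
  by move/eqP: p0; rewrite !mulf_eq0 => /orP[/eqP//|->]; rewrite orbT.
by move/eqP: q0; rewrite !mulf_eq0 => /orP[/eqP//|->]; rewrite orbT.
Qed.

(** Balls are taken in the sup norm, so some coordinate of [u] has absolute value at least [d]. It
    contributes at least [d ^+ 2 / 2] to the product, and the other coordinate at least
    [- (d ^+ 2 / 16)]. *)
Lemma dot2_gt0 (d : R) u v : 0 < d -> ~ ball 0 d u -> ball u (d / 2) v ->
  0 < dot2 u v.
Proof.
move=> d0 ud uv.
have [h0 h1] : `|u 0 0 - v 0 0| < d / 2 /\ `|u 0 i1 - v 0 i1| < d / 2.
  by case: uv => _ uv; split; [apply: (uv 0 0)|apply: (uv 0 i1)].
have : d <= `|u 0 0| \/ d <= `|u 0 i1|.
  have [|a] := leP d `|u 0 0|; first by left.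
  have [|b] := leP d `|u 0 i1|; first by right.
  exfalso; apply: ud; split=> // i j; rewrite ord1 mxE.
  have /orP[/eqP->|/eqP->] : (j == 0) || (j == i1) by case: j => -[|[|]].
    by rewrite /ball /= sub0r normrN.
  by rewrite /ball /= sub0r normrN.
rewrite /dot2; move: (u 0 0) (u 0 i1) (v 0 0) (v 0 i1) h0 h1 => a b a' b'.
rewrite !ltr_distl !ler_normr => /andP[h1 h2] /andP[h3 h4] H.
have sq (x y : R) : d <= x \/ d <= - x -> y - d / 2 < x < y + d/2 ->
  x ^+ 2 / 2 <= x * y.
  by move=> [xd|xd] /andP[p q]; nra.
have sm (x y : R) : y - d / 2 < x < y + d/2 -> - (d ^+ 2 / 16) <= x * y.
  move=> /andP[p q].
  have [x0|x0] := leP 0 x.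
    (* Completing the square: x (x - d/2) = (x - d/4)^2 - d^2/16. *)
    have : 0 <= (x - d / 4) ^+ 2 by exact: sqr_ge0.
    nra.
  have : 0 <= (x + d / 4) ^+ 2 by exact: sqr_ge0.
  nra.
have d2 : 0 < d ^+ 2 by exact: exprn_gt0.
have big (x : R) : d <= x \/ d <= - x -> d ^+ 2 <= x ^+ 2.
  by move=> [xd|xd]; nra.
case: H => /orP H.
  have h := big _ H; have h' := sq a a' H; have h'' := sm b b'.
  have := h' (introT andP (conj h1 h2)); have := h'' (introT andP (conj h3 h4)).
  lra.
have h := big _ H; have h' := sq b b' H; have h'' := sm a a'.
have := h' (introT andP (conj h3 h4)); have := h'' (introT andP (conj h1 h2)).
lra.
Qed.

End PlaneRotation.

(** * Angle lifts along the radii of a disk *)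

Section AngleLift.
Context {R : realType}.
Implicit Types U V : R * R -> 'rV[R]_2.

(** Discrete angle lift along the radius with parameter [s]: a sum of arctangents is a real number,
    not a class modulo 2 pi, so the intermediate value theorem applies to it. *)
Definition radial_angle (N : nat) U (s : R) : R :=
  \sum_(k < N) ang2 (U (k%:R / N%:R, s)) (U (k.+1%:R / N%:R, s)).

Lemma frac_I01 (k N : nat) : (k <= N)%N -> (0 < N)%N -> I01 (k%:R / N%:R : R).
Proof.
move=> kN N0; apply/I01P; rewrite divr_ge0 ?ler0n //=.
by rewrite ler_pdivrMr ?ltr0n// mul1r ler_nat.
Qed.

Lemma radial_angle_turned N U s : (0 < N)%N ->
  (forall k, (k < N)%N ->
     0 < dot2 (U (k%:R / N%:R, s)) (U (k.+1%:R / N%:R, s))) ->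
  turned (radial_angle N U s) (U (0, s)) (U (1, s)).
Proof.
move=> N0 H.
suff : forall m, (m <= N)%N -> turned
    (\sum_(k < m) ang2 (U (k%:R / N%:R, s)) (U (k.+1%:R / N%:R, s)))
    (U (0, s)) (U (m%:R / N%:R, s)).
  by move/(_ N (leqnn N)); rewrite divff// pnatr_eq0 -lt0n.
elim=> [|m IH] mN; first by rewrite big_ord0 mul0r; exact: turned0.
rewrite big_ord_recr /=; apply: turned_trans (IH (ltnW mN)) _.
exact/turned_ang2/H.
Qed.

Lemma radial_angle_continuous N U : (0 < N)%N ->
  {within I01 `*` I01, continuous U} ->
  (forall k s, (k < N)%N -> I01 s ->
     0 < dot2 (U (k%:R / N%:R, s)) (U (k.+1%:R / N%:R, s))) ->
  {within I01, continuous (radial_angle N U)}.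
Proof.
move=> N0 cU H.
have cc k i : (k <= N)%N -> {within I01, continuous (fun s => U (k%:R / N%:R, s) 0 i)}.
  move=> kN.
  have c1 : {within I01, continuous (fun s : R => U (k%:R / N%:R, s))}.
    apply: (within_comp (f := fun s : R => (k%:R / N%:R : R, s)) _ cU).
      apply: continuous_subspaceT; apply: continuous_pair => s; last exact: cvg_id.
      exact: cvg_cst.
    by move=> s Is; split => //=; exact: frac_I01.
  apply: (within_comp (B := setT) (g := fun v : 'rV[R]_2 => v 0 i) c1) => //.
  by apply: continuous_subspaceT; exact: coord_continuous.
apply/subspace_continuousP => s Is.
apply: (cvg_big add_continuous) => -[k kN] _ /=.
have cv m i (mN : (m <= N)%N) := (subspace_continuousP _ _).1 (cc m i mN) s Is.
apply: (cvg_comp _ (@atan R)); last exact: continuous_atan.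
apply: cvgM; first by apply: cvgB; apply: cvgM; apply: cv => //; exact: ltnW.
apply: cvgV; first by rewrite gt_eqF// H.
by apply: cvgD; apply: cvgM; apply: cv => //; exact: ltnW.
Qed.

(** The compact image of the square has a positive distance [d] from 0, and uniform continuity with
    [d / 2] brings consecutive samples close enough for [dot2_gt0]. All large [N] are allowed so
    that two maps can share one subdivision. *)
Lemma radial_subdivision U : {within I01 `*` I01, continuous U} ->
  (forall p, (I01 `*` I01) p -> U p <> 0) ->
  exists N0, forall N, (N0 <= N)%N -> (0 < N)%N /\
    forall k s, (k < N)%N -> I01 s ->
     0 < dot2 (U (k%:R / N%:R, s)) (U (k.+1%:R / N%:R, s)).
Proof.
move=> cU U0.
have cII : compact ((@I01 R) `*` (@I01 R)) by apply: compact_setX; exact: compact_I01.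
have [|||d d0 Hd] := @compact_gap R _ (U @` (I01 `*` I01)) [set 0].
- exact: continuous_compact.
- by apply: compact_closed; [exact: norm_hausdorff|exact: compact_set1].
- by apply/seteqP; split=> // u [[p Ip <-]] /= /(U0 _ Ip).
have d2 : 0 < d / 2 by rewrite divr_gt0.
have [e e0 He] := compact_unif_continuous cII cU d2.
(* Beyond this bound the step 1/N is shorter than [e]; the successor keeps [N] positive. *)
exists (Num.bound e^-1).+1 => N HN.
have N0 : (0 < N)%N by apply: leq_trans HN.
split=> // k s kN Is.
have kI : I01 (k%:R / N%:R : R) by apply: frac_I01 => //; exact: ltnW.
have kI' : I01 (k.+1%:R / N%:R : R) by exact: frac_I01.
apply: (dot2_gt0 d0).
  by move/ball_sym; apply: Hd => //; exists (k%:R / N%:R, s).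
apply: He => //; split=> /=; last exact: ballxx.
rewrite /ball /= -natr1 mulrDl opprD addrA addrN add0r normrN mul1r.
rewrite ger0_norm ?invr_ge0// invf_plt ?posrE ?ltr0n//.
apply: lt_le_trans (archi_boundP _) _; first by rewrite invr_ge0 ltW.
by rewrite ler_nat; apply: leq_trans HN.
Qed.

(* A nowhere zero map of the disk, given on its two halves by [U] and [V] in
   polar coordinates, cannot be odd on the boundary: it lifts to an angle
   function, and the increment of the lift between antipodal boundary points
   changes sign along a half circle, so it vanishes somewhere. *)
Lemma no_odd_boundary U V :
  {within I01 `*` I01, continuous U} -> {within I01 `*` I01, continuous V} ->
  (forall p, (I01 `*` I01) p -> U p <> 0) ->
  (forall p, (I01 `*` I01) p -> V p <> 0) ->
  (forall s, I01 s -> V (0, s) = U (0, s)) ->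
  (forall r, I01 r -> V (r, 0) = U (r, 1) /\ V (r, 1) = U (r, 0)) ->
  (forall s, I01 s -> V (1, s) = - U (1, s)) -> False.
Proof.
move=> cU cV U0 V0 UV0 UVr UV1.
have [NU HU] := radial_subdivision cU U0; have [NV HV] := radial_subdivision cV V0.
have [N0 {}HU] := HU (maxn NU NV) (leq_maxl _ _).
have [_ {}HV] := HV (maxn NU NV) (leq_maxr _ _).
set N := maxn NU NV in N0 HU HV.
pose d s := radial_angle N V s - radial_angle N U s.
have cd : {within I01, continuous d}.
  by move=> s; apply: continuousB; [exact: (radial_angle_continuous N0 cV HV)|
    exact: (radial_angle_continuous N0 cU HU)].
(* The two halves are glued crosswise along their end radii, so the lifts exchange their end values
   and [d] changes sign. *)
have VU0 : radial_angle N V 0 = radial_angle N U 1.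
  apply: eq_bigr => -[k kN] _ /=.
  by congr ang2; apply: (UVr _ _).1; apply: frac_I01 => //; exact: ltnW.
have VU1 : radial_angle N V 1 = radial_angle N U 0.
  apply: eq_bigr => -[k kN] _ /=.
  by congr ang2; apply: (UVr _ _).2; apply: frac_I01 => //; exact: ltnW.
have d1 : d 1 = - d 0 by rewrite /d VU0 VU1 opprB.
have [|s Is ds] := IVT ler01 cd (v := 0).
  by rewrite d1 ge_min le_max !oppr_le0 oppr_ge0 le_total orbC le_total.
have {}Is : I01 s by [].
have TU := radial_angle_turned N0 (fun k kN => HU k s kN Is).
have TV := radial_angle_turned N0 (fun k kN => HV k s kN Is).
have e : radial_angle N V s = radial_angle N U s by apply/eqP; rewrite -subr_eq0 -/(d s) ds.
(* Equal turning from the common centre value puts [U (1, s)] and its negative on the same ray. *)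
rewrite e UV0// UV1// in TV.
by apply: (U0 (1, s)); [split=> //=; apply/I01P; rewrite ler01 lexx|
  exact: turned_opp TU TV].
Qed.

End AngleLift.

(** * Points with prescribed barycentric coordinates *)

Section Barycentric.
Context {R : realType} (n d : nat) (f : 'I_d -> 'I_n) (f_inj : injective f).
Implicit Types c : 'I_d -> R.

Definition bary c : 'rV[R]_n := \sum_k c k *: delta_mx 0 (f k).

Lemma baryE c k : bary c 0 (f k) = c k.
Proof.
rewrite summxE (bigD1 k)//= !mxE !eqxx mulr1 big1 ?addr0// => i ik.
by rewrite !mxE eqxx (inj_eq f_inj) [k == i]eq_sym (negbTE ik) mulr0.
Qed.

Lemma bary_out c j : (forall k, f k != j) -> bary c 0 j = 0.
Proof.
move=> fj; rewrite summxE big1// => k _.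
by rewrite !mxE eqxx [j == _]eq_sym (negbTE (fj k)) mulr0.
Qed.

Lemma bary_face (s : {set 'I_n}) c : (forall k, f k \in s) ->
  (forall k, 0 <= c k) -> \sum_k c k = 1 -> std_face s (bary c).
Proof.
move=> fs c0 c1; split; [|split].
- move=> i; rewrite summxE; apply: sumr_ge0 => k _.
  by rewrite !mxE mulr_ge0// ler0n.
- under eq_bigr do rewrite summxE.
  rewrite exchange_big /= -c1; apply: eq_bigr => k _.
  rewrite (bigD1 (f k))//= !mxE !eqxx mulr1 big1 ?addr0// => i ik.
  by rewrite !mxE eqxx (negbTE ik) mulr0.
- move=> i si; apply: bary_out => k; apply/eqP => fk.
  by rewrite -fk fs in si.
Qed.

Lemma bary_continuous (T : topologicalType) (c : T -> 'I_d -> R) :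
  (forall k, continuous (c^~ k)) -> continuous (fun t => bary (c t)).
Proof.
move=> cc t; apply: (cvg_big add_continuous) => k _.
by apply: cvgZr_tmp; exact: cc.
Qed.

End Barycentric.

(** * A tetrahedron does not embed in the plane *)

Section NoPlanarTetrahedron.
Context {R : realType} (n : nat) (s : {set 'I_n}) (f : 'I_4 -> 'I_n).
Context (fs : forall i, f i \in s) (f_inj : injective f).

(** The fourth entry makes the weights add up to 1; the factor 1/8 keeps them positive on the solid
    octahedron. *)
Let oct4 (x y z : R) (k : 'I_4) : R := 4^-1 + nth 0 [:: x; y; z; - (x + y + z)] k / 8.

(* [|x| + |y| + |z| = 1] describes an octahedron around the barycentre of the
   face spanned by [f], with antipodal map [(x, y, z) |-> (-x, -y, -z)]. *)
Definition octahedron (x y z : R) : 'rV[R]_n := bary f (oct4 x y z).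

Lemma octahedron_face x y z : `|x| + `|y| + `|z| <= 1 ->
  std_face s (octahedron x y z).
Proof.
move=> xyz; apply: bary_face => // [k|].
  move: (ler_norm x) (ler_norm y) (ler_norm z).
  move: (ler_norm (-x)) (ler_norm (-y)) (ler_norm (-z)); rewrite !normrN.
  by rewrite /oct4; case: k => -[|[|[|[|]]]] //= _; lra.
by rewrite !big_ord_recl big_ord0 /oct4 /=; lra.
Qed.

Lemma octahedron_eq0 x y z : octahedron x y z = octahedron (- x) (- y) (- z) ->
  [/\ x = 0, y = 0 & z = 0].
Proof.
move=> /rowP e.
have h k : oct4 x y z k = oct4 (-x) (-y) (-z) k by rewrite -!(baryE f_inj) e.
have h0 := h (@Ordinal 4 0 isT); have h1 := h (@Ordinal 4 1 isT).
have h2 := h (@Ordinal 4 2 isT); rewrite /oct4 /= in h0 h1 h2.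
by split; lra.
Qed.

Lemma octahedron_continuous (T : topologicalType) (x y z : T -> R) :
  continuous x -> continuous y -> continuous z ->
  continuous (fun t => octahedron (x t) (y t) (z t)).
Proof.
move=> cx cy cz; apply: bary_continuous => k t; apply: cvgD; first exact: cvg_cst.
apply: cvgMr_tmp; case: k => -[|[|[|[|]]]] //= _; [exact: cx|exact: cy|exact: cz|].
by apply: cvgN; apply: cvgD; [apply: cvgD; [exact: cx|exact: cy]|exact: cz].
Qed.

(** For injective [phi] the difference of its values at antipodes never vanishes and is odd on the
    octahedral sphere. Its restriction to the half with nonnegative third coordinate is a disk map
    excluded by [no_odd_boundary]. *)
Lemma no_planar_tetrahedron (phi : 'rV[R]_n -> 'rV[R]_2) :
  {within std_face s, continuous phi} ->
  (forall x y, std_face s x -> std_face s y -> phi x = phi y -> x = y) -> False.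
Proof.
move=> cphi phi_inj.
(* Polar coordinates on the quarter with y, z >= 0: radius 0 is the pole and radius 1 the equator.
   [U] lives on this quarter, [V] on its image under (x, y, z) |-> (-x, -y, z). *)
pose X (p : R * R) : R := p.1 * (1 - 2 * p.2).
pose Y (p : R * R) : R := p.1 * (1 - `|1 - 2 * p.2|).
pose Z (p : R * R) : R := 1 - p.1.
have cfst : continuous (fun p : R * R => p.1) by move=> p; exact: cvg_fst.
have csnd : continuous (fun p : R * R => 1 - 2 * p.2 : R).
  by move=> p; apply: cvgB; [exact: cvg_cst|apply: cvgMl_tmp; exact: cvg_snd].
have cX : continuous X by move=> p; apply: cvgM; [exact: cfst|exact: csnd].
have cY : continuous Y.
  move=> p; apply: cvgM; first exact: cfst.
  by apply: cvgB; [exact: cvg_cst|apply: cvg_norm; exact: csnd].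
have cZ : continuous Z by move=> p; apply: cvgB; [exact: cvg_cst|exact: cfst].
have cN (h : R * R -> R) : continuous h -> continuous (fun p => - h p).
  by move=> ch p; apply: cvgN; exact: ch.
have XYZ p : (I01 `*` I01) p -> `|X p| + `|Y p| + `|Z p| = 1.
  case: p => r t [/= /I01P/andP[r0 r1] /I01P/andP[t0 t1]].
  have t2 : `|1 - 2 * t| <= 1 by rewrite ler_norml; apply/andP; split; lra.
  rewrite /X /Y /Z /= !normrM (ger0_norm r0).
  by rewrite (@ger0_norm _ (1 - `|1 - 2 * t|)) ?subr_ge0// (@ger0_norm _ (1 - r)) ?subr_ge0//; ring.
have face p (x y z : R) : (I01 `*` I01) p -> `|x| = `|X p| -> `|y| = `|Y p| ->
    `|z| = `|Z p| -> std_face s (octahedron x y z).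
  by move=> Ip ex ey ez; apply: octahedron_face; rewrite ex ey ez XYZ.
pose U p := phi (octahedron (X p) (Y p) (Z p)) -
            phi (octahedron (- X p) (- Y p) (- Z p)).
pose V p := phi (octahedron (- X p) (- Y p) (Z p)) -
            phi (octahedron (X p) (Y p) (- Z p)).
have cw (x y z : R * R -> R) : continuous x -> continuous y -> continuous z ->
    (forall p, `|x p| = `|X p|) -> (forall p, `|y p| = `|Y p|) ->
    (forall p, `|z p| = `|Z p|) ->
    {within I01 `*` I01, continuous (fun p => phi (octahedron (x p) (y p) (z p)))}.
  move=> cx cy cz ex ey ez.
  apply: (within_comp (f := fun p => octahedron (x p) (y p) (z p)) _ cphi).
    by apply: continuous_subspaceT; exact: octahedron_continuous.
  by move=> p Ip; apply: (face p).
have sub0 (p q : 'rV[R]_n) : std_face s p -> std_face s q -> phi p - phi q = 0 -> p = q.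
  by move=> sp sq /eqP; rewrite subr_eq0 => /eqP; exact: phi_inj.
have nz p : (I01 `*` I01) p -> X p = 0 -> Y p = 0 -> Z p = 0 -> False.
  move=> Ip x0 y0 z0; have := XYZ p Ip; rewrite x0 y0 z0 !normr0 !addr0.
  by move/eqP; rewrite eq_sym oner_eq0.
apply: (@no_odd_boundary R U V).
- by move=> p; apply: cvgB; [apply: (cw X Y Z)|apply: (cw (fun p => - X p)
    (fun p => - Y p) (fun p => - Z p))] => //; try exact: cN; move=> ?; exact: normrN.
- by move=> p; apply: cvgB; [apply: (cw (fun p => - X p) (fun p => - Y p) Z)|
    apply: (cw X Y (fun p => - Z p))] => //; try exact: cN; move=> ?; exact: normrN.
- move=> p Ip /sub0 => /(_ (face p _ _ _ Ip erefl erefl erefl)).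
  move=> /(_ (face p _ _ _ Ip (normrN _) (normrN _) (normrN _))).
  by move/octahedron_eq0 => [x0 y0 z0]; exact: (nz p).
- move=> p Ip /sub0 => /(_ (face p _ _ _ Ip (normrN _) (normrN _) erefl)).
  move=> /(_ (face p _ _ _ Ip erefl erefl (normrN _))).
  rewrite -{1}(opprK (Z p)) => /esym/octahedron_eq0[x0 y0 /eqP z0].
  by apply: (nz p) => //; apply/eqP; rewrite -oppr_eq0.
- by move=> t It; rewrite /U /V /X /Y /=; congr (phi (octahedron _ _ _) - phi (octahedron _ _ _)); ring.
- have e1 : `|1 - 2 * 1 : R| = 1 by rewrite (_ : 1 - 2 * 1 = -1) ?normrN1//; ring.
  have e0 : `|1 - 2 * 0 : R| = 1 by rewrite mulr0 subr0 normr1.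
  move=> r Ir; rewrite /U /V /X /Y /Z /= e0 e1.
  by split; congr (phi (octahedron _ _ _) - phi (octahedron _ _ _)); ring.
- move=> t It; rewrite /U /V /Z /= subrr oppr0 opprB.
  by congr (_ - _).
Qed.

End NoPlanarTetrahedron.

(** * Gauges and radial homeomorphisms *)

Section FiniteBigops.
Context {R : realType} (T : topologicalType) (I : finType) (f : I -> T -> R).
Context (cf : forall i, continuous (f i)).

Lemma continuous_sumr : continuous (fun x => \sum_i f i x).
Proof. by move=> x; apply: (cvg_big add_continuous) => i _; exact: cf. Qed.

Lemma continuous_bigmaxr : continuous (fun x => \big[Num.max/0]_i f i x).
Proof.
by move=> x; apply: (cvg_big (@max_continuous _ R)) => i _; exact: cf.
Qed.

End FiniteBigops.

Lemma continuous_square {R : realType} (T : topologicalType) (g : T -> R) :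
  continuous g -> continuous (fun x => g x ^+ 2).
Proof. by move=> cg x; apply: cvgM; exact: cg. Qed.

Section RadialHomeomorphism.
Context {R : realType} {V : normedModType R}.

(** Modelled on the Minkowski functional of a bounded star-shaped neighbourhood of 0; the comparison
    with the norm expresses boundedness and gives positivity away from 0. *)
Definition gauge_like (p : V -> R) := continuous p /\
  (forall t x, 0 <= t -> p (t *: x) = t * p x) /\ (forall x, `|x| <= p x).

(** Maps the unit ball of [p] onto that of [q] along rays. At the origin the quotient is 0/0 = 0,
    and the value is 0 in any case. *)
Definition radial_map (p q : V -> R) (x : V) : V := (p x / q x) *: x.

Context (p q : V -> R) (gp : gauge_like p) (gq : gauge_like q).

Let hp t x : 0 <= t -> p (t *: x) = t * p x. Proof. exact: gp.2.1. Qed.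
Let hq t x : 0 <= t -> q (t *: x) = t * q x. Proof. exact: gq.2.1. Qed.
Let p00 : p 0 = 0. Proof. by rewrite -(scale0r 0) hp// mul0r. Qed.
Let q00 : q 0 = 0. Proof. by rewrite -(scale0r 0) hq// mul0r. Qed.
Let p_ge0 x : 0 <= p x. Proof. exact: le_trans (gp.2.2 x). Qed.
Let q_ge0 x : 0 <= q x. Proof. exact: le_trans (gq.2.2 x). Qed.
Let p_gt0 x : x != 0 -> 0 < p x.
Proof. by rewrite -normr_gt0 => /lt_le_trans; apply; exact: gp.2.2. Qed.
Let q_gt0 x : x != 0 -> 0 < q x.
Proof. by rewrite -normr_gt0 => /lt_le_trans; apply; exact: gq.2.2. Qed.

Lemma radial_map_gauge x : q (radial_map p q x) = p x.
Proof.
have [->|x0] := eqVneq x 0; first by rewrite /radial_map scaler0 q00 p00.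
by rewrite hq ?divr_ge0// divfK// gt_eqF// q_gt0.
Qed.

Lemma radial_mapK : cancel (radial_map p q) (radial_map q p).
Proof.
move=> x; rewrite /radial_map -/(radial_map p q x) radial_map_gauge.
have [->|x0] := eqVneq x 0; first by rewrite /radial_map !scaler0.
rewrite hp ?divr_ge0// scalerA.
rewrite (_ : _ * _ = 1) ?scale1r//; field.
by rewrite !gt_eqF ?p_gt0 ?q_gt0.
Qed.

(** The delicate point is the origin: since the norm of [y] is at most [q y], the norm of the image
    is at most [p y], which tends to 0. *)
Lemma radial_map_continuous : continuous (radial_map p q).
Proof.
move=> x; have [->|x0] := eqVneq x 0.
  rewrite /continuous_at {2}/radial_map scaler0.
  apply/norm_cvg0P; apply: (squeeze_cvgr (f := cst 0) (h := p)).
  - near=> y; rewrite normr_ge0 /= normrZ ger0_norm ?divr_ge0//.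
    have [->|y0] := eqVneq y 0; first by rewrite normr0 mulr0 p_ge0.
    by rewrite mulrAC ler_pdivrMr ?q_gt0// ler_wpM2l// gq.2.2.
  - exact: cvg_cst.
  - by rewrite -p00; exact: gp.1.
apply: cvgZ; last exact: cvg_id.
apply: cvgM; first exact: gp.1.
by apply: cvgV; [rewrite gt_eqF// q_gt0|exact: gq.1].
Unshelve. all: by end_near. Qed.

End RadialHomeomorphism.

(** * The Euclidean norm and the simplex as gauges *)

Section Gauges.
Context {R : realType} (d : nat).
Implicit Types x : 'rV[R]_d.

Lemma row_norm_le x (r : R) : 0 <= r -> (forall i, `|x 0 i| <= r) -> `|x| <= r.
Proof.
move=> r0 H; rewrite [leLHS]/Num.norm /= mx_normrE.
by apply/bigmax_leP; split=> // -[i j] _ /=; rewrite ord1.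
Qed.

Lemma coord_le_norm x i : `|x 0 i| <= `|x|.
Proof.
rewrite [leRHS]/Num.norm /= mx_normrE.
exact: (le_bigmax _ (fun ij : 'I_1 * 'I_d => `|x ij.1 ij.2|) (0, i)).
Qed.

Lemma sqr_enorm x : enorm x ^+ 2 = \sum_i x 0 i ^+ 2.
Proof. by rewrite sqr_sqrtr// sumr_ge0// => i _; exact: sqr_ge0. Qed.

Lemma enorm_ge0 x : 0 <= enorm x.
Proof. exact: sqrtr_ge0. Qed.

Lemma coord_le_enorm x i : `|x 0 i| <= enorm x.
Proof.
rewrite -sqrtr_sqr ler_sqrt ?sumr_ge0// => [|j _]; last exact: sqr_ge0.
by rewrite (bigD1 i)//= lerDl sumr_ge0// => j _; exact: sqr_ge0.
Qed.

Lemma gauge_like_enorm : gauge_like (@enorm R d).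
Proof.
split; [|split].
- move=> x; apply: (continuous_comp (f := fun y : 'rV[R]_d => \sum_i y 0 i ^+ 2)).
    apply: continuous_sumr => i; apply: continuous_square; exact: coord_continuous.
  exact: sqrt_continuous.
- move=> t x t0; rewrite /enorm -{2}(ger0_norm t0) -sqrtr_sqr -sqrtrM ?sqr_ge0//.
  congr Num.sqrt; rewrite mulr_sumr; apply: eq_bigr => i _.
  by rewrite mxE exprMn.
- by move=> x; apply: row_norm_le => [|i]; [exact: enorm_ge0|exact: coord_le_enorm].
Qed.

(* Barycentric coordinates of [x] in the simplex whose barycentre is the
   origin, shifted so that they sum to 0. *)
Definition bary0 x (k : 'I_d.+1) : R :=
  if unlift ord_max k is Some j then x 0 j else - \sum_j x 0 j.

Lemma bary0_lift x j : bary0 x (lift ord_max j) = x 0 j.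
Proof. by rewrite /bary0 liftK. Qed.

Lemma bary0_sum x : \sum_k bary0 x k = 0.
Proof.
rewrite (bigD1_ord ord_max)//= {1}/bary0 unlift_none.
by under eq_bigr do rewrite bary0_lift; rewrite addNr.
Qed.

Lemma bary0Z t x k : bary0 (t *: x) k = t * bary0 x k.
Proof.
rewrite /bary0; case: unliftP => [j _|_]; first by rewrite mxE.
by rewrite mulrN mulr_sumr; under eq_bigr do rewrite mxE.
Qed.

Lemma bary0_continuous k : continuous (bary0^~ k).
Proof.
rewrite /bary0; case: unliftP => [j _|_] x; first exact: coord_continuous.
apply: continuousN; apply: continuous_sumr => j; exact: coord_continuous.
Qed.

(** Minkowski functional of the centred simplex: nonnegativity of the weight 1/(d+1) + [bary0 x k]
    says that the k-th term is at most 1. The default 0 is harmless, as the terms sum to 0. *)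
Definition simplex_gauge x : R := \big[Num.max/0]_k (- (d.+1%:R * bary0 x k)).

Lemma simplex_gauge_le x (r : R) : 0 <= r ->
  (simplex_gauge x <= r) <-> (forall k, - (d.+1%:R * bary0 x k) <= r).
Proof.
move=> r0; split=> [/bigmax_leP[_ H] k|H]; first exact: H.
by apply/bigmax_leP; split.
Qed.

Lemma simplex_gauge_lt x (r : R) : 0 < r ->
  (simplex_gauge x < r) <-> (forall k, - (d.+1%:R * bary0 x k) < r).
Proof.
move=> r0; split=> [/bigmax_ltP[_ H] k|H]; first exact: H.
by apply/bigmax_ltP; split.
Qed.

Lemma simplex_gauge_ge0 x : 0 <= simplex_gauge x.
Proof. exact: bigmax_ge_id. Qed.

Lemma gauge_like_simplex : gauge_like simplex_gauge.
Proof.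
split; [|split].
- have cN (T : topologicalType) (c : R) (g : T -> R) : continuous g ->
      continuous (fun y => - (c * g y)).
    by move=> cg x; apply: cvgN; apply: cvgMl_tmp; exact: cg.
  by apply: continuous_bigmaxr => k; apply: cN; exact: bary0_continuous.
- move=> t x; rewrite le_eqVlt => /orP[/eqP <-|t0].
    rewrite mul0r; apply/eqP; rewrite eq_le simplex_gauge_ge0 andbT.
    by apply/simplex_gauge_le => // k; rewrite bary0Z mul0r mulr0 oppr0.
  apply/eqP; rewrite eq_le; apply/andP; split.
    apply/simplex_gauge_le => [|k]; first by rewrite mulr_ge0 ?simplex_gauge_ge0// ltW.
    rewrite bary0Z mulrCA -mulrN ler_pM2l//.
    exact: (simplex_gauge_le _ (simplex_gauge_ge0 _)).1.
  rewrite -ler_pdivlMl//; apply/simplex_gauge_le => [|k].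
    by rewrite mulr_ge0 ?simplex_gauge_ge0// invr_ge0 ltW.
  rewrite ler_pdivlMl// mulrN mulrCA -bary0Z.
  exact: (simplex_gauge_le _ (simplex_gauge_ge0 _)).1.
- move=> x; have g0 := simplex_gauge_ge0 x; apply: row_norm_le => // j.
  have H k : - bary0 x k <= simplex_gauge x / d.+1%:R.
    rewrite ler_pdivlMr ?ltr0n// mulNr mulrC.
    exact: (simplex_gauge_le _ (simplex_gauge_ge0 _)).1.
  rewrite -bary0_lift ler_norml lerNl; apply/andP; split.
    apply: le_trans (H _) _; rewrite ler_pdivrMr ?ltr0n// ler_peMr//.
    by rewrite ler1n.
  (* Upper bound: this coordinate is the sum of the negatives of the d others, each at most the
     gauge divided by d + 1. *)
  have := bary0_sum x; rewrite (bigD1 (lift ord_max j))//= => /eqP.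
  rewrite addr_eq0 => /eqP ->; rewrite -sumrN.
  apply: (@le_trans _ _ (\sum_(k < d.+1) simplex_gauge x / d.+1%:R)).
    rewrite [leRHS](bigD1 (lift ord_max j))//= -[leLHS]add0r lerD ?divr_ge0//.
    by apply: ler_sum => k _.
  by rewrite sumr_const card_ord -[_ *+ _]mulr_natr divfK// pnatr_eq0.
Qed.

End Gauges.

(** * A simplex is a Euclidean ball *)

Section SimplexBall.
Context {R : realType} (n : nat).
Implicit Types (s t : {set 'I_n}) (y : 'rV[R]_n).

Lemma std_faceS s t y : s \subset t -> std_face s y -> std_face t y.
Proof.
move=> /fintype.subsetP st [y0 [y1 ys]]; split=> //; split=> // i ti.
by apply: ys; apply: contra ti; exact: st.
Qed.

Lemma std_faceI s t y : std_face s y -> std_face t y -> std_face (s :&: t)%SET y.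
Proof.
move=> [y0 [y1 ys]] [_ [_ yt]]; split=> //; split=> // i.
by rewrite finset.in_setI negb_and => /orP[]; [exact: ys|exact: yt].
Qed.

Lemma std_face_ex s y : std_face s y -> exists2 i, i \in s & 0 < y 0 i.
Proof.
move=> [y0 [y1 ys]]; apply: contrapT => H.
suff : \sum_i y 0 i = 0 by rewrite y1 => /eqP; rewrite oner_eq0.
apply: big1 => i _; apply/eqP; rewrite eq_le y0 andbT leNgt; apply/negP => yi.
apply: H; exists i => //; apply/negPn/negP => si.
by move: yi; rewrite ys// ltxx.
Qed.

Context (d : nat) (s : {set 'I_n}) (f : 'I_d.+1 -> 'I_n).
Context (f_inj : injective f) (fs : forall k, f k \in s)
  (sf : forall j, j \in s -> exists k, j = f k).

Let simplex_map (x : 'rV[R]_d) : 'rV[R]_n := bary f (fun k => d.+1%:R^-1 + bary0 x k).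
(** The weight of the last vertex is dropped; it is recovered from the total weight 1. *)
Let simplex_inv y : 'rV[R]_d := \row_j (y 0 (f (lift ord_max j)) - d.+1%:R^-1).

Let d1 : 0 < d.+1%:R :> R. Proof. by rewrite ltr0n. Qed.

Let coordE (b : R) : (d.+1%:R^-1 + b) = d.+1%:R^-1 * (1 - - (d.+1%:R * b)).
Proof. by rewrite opprK mulrDr mulr1 mulKf// gt_eqF. Qed.

Let simplex_map_face x : simplex_gauge x <= 1 -> std_face s (simplex_map x).
Proof.
move=> /simplex_gauge_le H; apply: bary_face => // [k|].
  by rewrite coordE; apply: mulr_ge0; rewrite ?invr_ge0 ?(ltW d1)// subr_ge0 H.
rewrite big_split /= bary0_sum addr0 sumr_const card_ord -[_ *+ _]mulr_natl.
by rewrite divff// gt_eqF.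
Qed.

Let simplex_mapK : cancel simplex_map simplex_inv.
Proof.
by move=> x; apply/rowP => j; rewrite mxE baryE// bary0_lift addrC addKr.
Qed.

Let bary0_inv y : std_face s y -> forall k, d.+1%:R^-1 + bary0 (simplex_inv y) k = y 0 (f k).
Proof.
move=> [y0 [y1 ys]] k.
have sy : \sum_k y 0 (f k) = 1.
  rewrite -y1 (bigID [in s]) /= [X in _ + X]big1 ?addr0; last by move=> i; exact: ys.
  (* The pick inverts [f] on [s]; its default is never reached there. *)
  rewrite (reindex_onto f (fun j => odflt ord_max [pick k | f k == j])) /=.
    apply: eq_bigl => i; rewrite fs /=; case: pickP => [k' /eqP/f_inj -> |/(_ i)].
      by rewrite eqxx.
    by rewrite eqxx.
  move=> j /sf[k' ->]; case: pickP => [k'' /eqP//|/(_ k')]; by rewrite eqxx.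
case: (unliftP ord_max k) => [j ->|->]; first by rewrite bary0_lift mxE addrC subrK.
rewrite /bary0 unlift_none; under eq_bigr do rewrite mxE.
move: sy; rewrite (bigD1_ord ord_max)//= => /eqP; rewrite eq_sym -subr_eq => /eqP <-.
rewrite sumrB sumr_const card_ord opprB addrA -mulrS -[_ *+ _]mulr_natr.
by rewrite mulVf// gt_eqF.
Qed.

Let simplex_invK y : std_face s y -> simplex_map (simplex_inv y) = y.
Proof.
move=> sy; apply/rowP => j; case: (boolP (j \in s)) => [/sf[k ->]|js].
  by rewrite baryE// bary0_inv.
rewrite bary_out; last by move=> k; apply: contra js => /eqP <-; exact: fs.
by rewrite sy.2.2.
Qed.

Let simplex_inv_gauge y : std_face s y -> simplex_gauge (simplex_inv y) <= 1.
Proof.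
move=> sy; apply/simplex_gauge_le => // k.
have := bary0_inv sy k; rewrite coordE => e.
by rewrite -subr_ge0 -(pmulr_rge0 _ (_ : 0 < d.+1%:R^-1)) ?invr_gt0// e sy.1.
Qed.

(** The radial map from the Euclidean ball to the gauge ball is followed by the affine map that
    sends 0 to the barycentre. Gauges are preserved, so the open ball corresponds to the points with
    all weights positive. *)
Lemma face_ball_homeo : exists (h : 'rV[R]_d -> 'rV[R]_n) (k : 'rV[R]_n -> 'rV[R]_d),
  [/\ continuous h, continuous k, cancel h k,
      (forall x, enorm x <= 1 -> std_face s (h x)) /\
      (forall y, std_face s y -> h (k y) = y /\ enorm (k y) <= 1) &
      forall x, (enorm x < 1) <-> (forall j, j \in s -> 0 < h x 0 j)].
Proof.
have ge := @gauge_like_enorm R d; have gs := @gauge_like_simplex R d.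
exists (fun x => simplex_map (radial_map (@enorm R d) (@simplex_gauge R d) x)).
exists (fun y => radial_map (@simplex_gauge R d) (@enorm R d) (simplex_inv y)).
split.
- have cs : continuous simplex_map.
    apply: bary_continuous => k.
    have cD (T : topologicalType) (g : T -> R) : continuous g ->
        continuous (fun z => d.+1%:R^-1 + g z).
      by move=> cg z; apply: cvgD; [exact: cvg_cst|exact: cg].
    by apply: cD; exact: bary0_continuous.
  by move=> x; apply: continuous_comp; [exact: radial_map_continuous|exact: cs].
- have ci : continuous simplex_inv.
    have -> : simplex_inv = fun y => \sum_j (y 0 (f (lift ord_max j)) - d.+1%:R^-1) *: delta_mx 0 j.
      apply/funext => y; apply/rowP => j; rewrite !mxE summxE (bigD1 j)//= !mxE !eqxx.
      rewrite mulr1 big1 ?addr0// => i ij.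
      by rewrite !mxE eqxx [j == i]eq_sym (negbTE ij) mulr0.
    have cB (T : topologicalType) (g : T -> R) : continuous g ->
        continuous (fun z => g z - d.+1%:R^-1).
      by move=> cg z; apply: cvgB; [exact: cg|exact: cvg_cst].
    by apply: (@bary_continuous _ _ _ id) => j; apply: cB; exact: coord_continuous.
  by move=> x; apply: continuous_comp; [exact: ci|exact: radial_map_continuous].
- by move=> x /=; rewrite simplex_mapK radial_mapK.
- split=> [x x1|y sy]; first by apply: simplex_map_face; rewrite radial_map_gauge.
  rewrite radial_mapK// simplex_invK// radial_map_gauge//; split=> //.
  exact: simplex_inv_gauge.
- move=> x; rewrite -(radial_map_gauge ge gs x); set z := radial_map _ _ x.
  split=> [/(simplex_gauge_lt _ ltr01) H j /sf[k ->]|H].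
    by rewrite baryE// coordE; apply: mulr_gt0; rewrite ?invr_gt0 ?subr_gt0.
  apply/simplex_gauge_lt => // k; have := H _ (fs k).
  by rewrite baryE// coordE pmulr_rgt0 ?invr_gt0// subr_gt0.
Qed.

End SimplexBall.

(** * Triangulations of the disk as cell complexes *)

Section Triangulations.
Context {R : realType} (K : @triangulation R).
Notation n := (tri_n K).
Implicit Types (s t : {set 'I_n}) (y : 'rV[R]_n).

Definition realization : set 'rV[R]_n :=
  \bigcup_(s in [set` tri_simplices K]) std_face s.

Lemma std_face_realization s : s \in tri_simplices K ->
  std_face s `<=` realization.
Proof. by move=> sK y sy; exists s. Qed.

Lemma tri_map_inj y z : realization y -> realization z ->
  tri_map y = tri_map z -> y = z.
Proof.
move: (tri_homeo K) => [_ [[_ inj _] _]] yK zK; apply: inj; exact/mem_set.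
Qed.

Lemma tri_map_face_continuous s : s \in tri_simplices K ->
  {within std_face s, continuous (@tri_map R K)}.
Proof.
move=> sK; apply: (continuous_subspaceW (std_face_realization sK)).
by case: (tri_homeo K).
Qed.

Lemma tri_map_disk y : realization y -> disk (tri_map y).
Proof. by move: (tri_homeo K) => [_ [[fun_ _ _] _]]; exact: fun_. Qed.

Lemma disk_tri_cell x : disk x -> exists2 s, s \in tri_simplices K & tri_cell s x.
Proof.
move: (tri_homeo K) => [_ [[_ _ surj] _]] /surj[y [s sK sy] <-].
by exists s => //; exists y.
Qed.

Lemma tri_cellI s t x : s \in tri_simplices K -> t \in tri_simplices K ->
  tri_cell s x -> tri_cell t x -> tri_cell (s :&: t)%SET x.
Proof.
move=> sK tK [y sy <-] [z tz] /tri_map_inj zy.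
have e : z = y by apply: zy; [exact: std_face_realization tz|exact: std_face_realization sy].
by rewrite e in tz; exists y => //; exact: std_faceI.
Qed.

Lemma tri_cell_disk s : s \in tri_simplices K -> tri_cell s `<=` disk.
Proof. by move=> sK _ [y sy <-]; apply: tri_map_disk; exact: (std_face_realization sK). Qed.

Lemma card_simplex_gt0 s : s \in tri_simplices K -> (0 < #|s|)%N.
Proof.
move=> sK; rewrite card_gt0; apply: contraTneq sK => ->; exact: (tri_nonempty K).
Qed.

(** Four vertices of a larger simplex would span a tetrahedron embedded in the plane by
    [tri_map]. *)
Lemma card_simplex_le3 s : s \in tri_simplices K -> (#|s| <= 3)%N.
Proof.
move=> sK; rewrite leqNgt; apply/negP => s4.
apply: (@no_planar_tetrahedron R n s (fun k => enum_val (widen_ord s4 k)) _ _ (@tri_map R K)).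
- by move=> k; exact: enum_valP.
- by move=> k l /enum_val_inj/(congr1 val) /= kl; exact: val_inj.
- exact: tri_map_face_continuous.
- by move=> y z sy sz; apply: tri_map_inj; exact: std_face_realization sK _ _.
Qed.

(** Open cells and boundaries are expressed by barycentric coordinates because the axioms of a cell
    complex then become statements about supports. *)
Lemma simplex_cell s d : s \in tri_simplices K -> #|s| = d.+1 ->
  exists m : 'rV[R]_d -> 'rV[R]_2,
  [/\ homeomorphism (eball d) (m @` eball d) m,
      m @` eball d = tri_cell s,
      m @` eball_int d =
        (@tri_map R K) @` [set y | std_face s y /\ forall j, j \in s -> 0 < y 0 j] &
      m @` esphere d =
        (@tri_map R K) @` [set y | std_face s y /\ exists2 j, j \in s & y 0 j = 0]].
Proof.
move=> sK sd.
pose f (k : 'I_d.+1) := enum_val (cast_ord (esym sd) k).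
have fs k : f k \in s by exact: enum_valP.
have f_inj : injective f by move=> k l /enum_val_inj/cast_ord_inj.
have sf j : j \in s -> exists k, j = f k.
  move=> js; exists (cast_ord sd (enum_rank_in js j)).
  by rewrite /f cast_ordK enum_rankK_in.
have [h [k [ch ck hk [hs ks] h1]]] := @face_ball_homeo R n d s f f_inj fs sf.
pose m := @tri_map R K \o h.
have mE : m @` eball d = tri_cell s.
  apply/seteqP; split=> [_ [x x1 <-]|_ [x /ks[hkx kx1] <-]].
    by exists (h x) => //; exact: hs.
  by exists (k x) => //; rewrite /m /= hkx.
have sph x : enorm x <= 1 -> enorm x = 1 <-> exists2 j, j \in s & h x 0 j = 0.
  move=> x1; split=> [xe|[j js hj]].
    apply: contrapT => H; suff : enorm x < 1 by rewrite xe ltxx.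
    apply/h1 => j js; rewrite lt_neqAle (hs _ x1).1 andbT eq_sym.
    by apply/negP => /eqP hj; apply: H; exists j.
  apply/eqP; rewrite eq_le x1 leNgt; apply/negP => /h1/(_ _ js).
  by rewrite hj ltxx.
exists m; split=> //.
- split; last split.
  + apply: (within_comp (B := std_face s) (f := h)) => //.
      exact: continuous_subspaceT.
    exact: tri_map_face_continuous.
  + split.
    * by move=> x x1; exists x.
    * move=> x y /set_mem x1 /set_mem y1 e; rewrite -(hk x) -(hk y); congr k.
      by apply: tri_map_inj e; apply: (std_face_realization sK); exact: hs.
    * by move=> _ [x x1 <-]; exists x.
  + move: (tri_homeo K) => [_ [_ [g [cg gK]]]]; exists (k \o g); split.
      rewrite mE; apply: (within_comp (f := g) (B := setT)) => //.
        exact: (continuous_subspaceW (tri_cell_disk sK) cg).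
      exact: continuous_subspaceT.
    move=> x x1 /=; rewrite gK ?hk//.
    by apply: (std_face_realization sK); exact: hs.
- apply/seteqP; split=> [_ [x x1 <-]|_ [x [sx x0] <-]].
    by exists (h x) => //; split; [apply: hs; exact: ltW|exact/h1].
  by have [hx kx] := ks _ sx; exists (k x); rewrite /m /= ?hx//; apply/h1; rewrite hx.
- apply/seteqP; split=> [_ [x x1 <-]|_ [x [sx x0] <-]].
    exists (h x) => //; have x1' : enorm x <= 1 by rewrite x1.
    by split; [exact: hs|apply/sph].
  by have [hx kx] := ks _ sx; exists (k x); rewrite /m /= ?hx//; apply/sph; rewrite ?hx.
Qed.

Lemma triangulation_cell_complex : exists T : @cell_complex R,
  cc_skel1 T `<=` tri_skel1 K /\
  forall sigma, two_cells T sigma ->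
    exists2 s, s \in tri_simplices K & sigma = tri_cell s.
Proof.
pose N := #|tri_simplices K|.
pose S (i : 'I_N) : {set 'I_n} := enum_val i.
have SK i : S i \in tri_simplices K by exact: enum_valP.
have S_inj : injective S by exact: enum_val_inj.
have SE s : s \in tri_simplices K -> exists i, S i = s.
  by move=> sK; exists (enum_rank_in sK s); rewrite /S enum_rankK_in.
(* The default of [inord] is never taken, as the cardinality lies between 1 and 3. *)
pose D (i : 'I_N) : 'I_3 := inord #|S i|.-1.
have DE i : #|S i| = (D i).+1.
  have := card_simplex_gt0 (SK i); have := card_simplex_le3 (SK i).
  by rewrite /D; case: #|S i| => [//|c] c3 _ /=; rewrite inordK.
have [m Hm] : {m : forall i, 'rV[R]_(D i) -> 'rV[R]_2 | forall i,
  [/\ homeomorphism (eball (D i)) (m i @` eball (D i)) (m i),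
      m i @` eball (D i) = tri_cell (S i),
      m i @` eball_int (D i) =
        (@tri_map R K) @` [set y | std_face (S i) y /\ forall j, j \in S i -> 0 < y 0 j] &
      m i @` esphere (D i) =
        (@tri_map R K) @` [set y | std_face (S i) y /\ exists2 j, j \in S i & y 0 j = 0]]}.
  exists (fun i => projT1 (cid (simplex_cell (SK i) (DE i)))) => i.
  exact: (projT2 (cid (simplex_cell (SK i) (DE i)))).
have cover : \bigcup_i (m i @` eball (D i)) = disk.
  apply/seteqP; split=> [x [i _]|x /disk_tri_cell[s sK sx]].
    by have [_ -> _ _] := Hm i => /(tri_cell_disk (SK i)).
  by have [i e] := SE s sK; exists i => //; have [_ -> _ _] := Hm i; rewrite e.
have disj i j : i != j -> (m i @` eball_int (D i)) `&` (m j @` eball_int (D j)) = set0.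
  move=> ij; have [_ _ -> _] := Hm i; have [_ _ -> _] := Hm j.
  apply/seteqP; split=> // _ [[y [sy y0] <-] [z [sz z0] /tri_map_inj e]].
  have {}e : z = y by apply: e; [exact: std_face_realization sz|exact: std_face_realization sy].
  (* The vertices of positive weight of the common point determine its simplex. *)
  subst z; move/eqP: ij; apply; apply: S_inj; apply/setP => v; apply/idP/idP => vS.
    by apply/negPn/negP => /sz.2.2 yv; have := y0 _ vS; rewrite yv ltxx.
  by apply/negPn/negP => /sy.2.2 yv; have := z0 _ vS; rewrite yv ltxx.
have bd i : m i @` esphere (D i) =
    \bigcup_(j in [set j | (D j < D i)%N /\ m j @` eball (D j) `<=` m i @` esphere (D i)])
      (m j @` eball (D j)).
  apply/seteqP; split=> [x|x [j [_ sub] /sub]//].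
  have [_ _ _ bE] := Hm i; rewrite bE => -[y [sy [v vS yv]] <-].
  (* Removing a vertex of weight 0 leaves a face of lower dimension that still contains [y]. *)
  have sy' : std_face (S i :\ v)%SET y.
    split; first exact: sy.1; split; first exact: sy.2.1.
    by move=> w; rewrite !inE negb_and negbK => /orP[/eqP->//|]; exact: sy.2.2.
  have S'K : (S i :\ v)%SET \in tri_simplices K.
    apply: tri_faces (SK i) (finset.subsetDl _ _) _.
    by have [w wS _] := std_face_ex sy'; apply/set0Pn; exists w.
  have [j Sj] := SE _ S'K; have [_ cE _ _] := Hm j.
  exists j; last by rewrite cE Sj; exists y.
  split; first by rewrite -ltnS -!DE Sj [X in (_ < X)%N](cardsD1 v) vS.
  rewrite cE Sj => _ [z sz <-]; exists z => //; split.
    by apply: std_faceS sz; exact: finset.subsetDl.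
  by exists v => //; apply: sz.2.2; rewrite !inE eqxx.
exists (@CellComplex R N D m (fun i => let: And4 h _ _ _ := Hm i in h) cover disj bd).
split=> [x [i /= Di Sx]|_ [i /= _ <-]]; have [_ cE _ _] := Hm i.
  change ((m i @` eball (D i)) x) in Sx; rewrite cE in Sx.
  by exists (S i) => //=; rewrite DE ltnS.
by exists (S i).
Qed.

End Triangulations.

(** * Gluing paths and chaining along the unit interval *)

Section Paths.
Context {R : realType}.

Lemma path_glue (T : topologicalType) (a b c : R) (p q : R -> T) :
  a <= b <= c -> {within `[a, b], continuous p} -> {within `[b, c], continuous q} ->
  p b = q b -> exists r : R -> T, [/\ {within `[a, c], continuous r},
    (forall z, a <= z <= b -> r z = p z) & (forall z, b <= z <= c -> r z = q z)].
Proof.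
move=> /andP[ab bc] cp cq pq.
pose r z := if z <= b then p z else q z.
have rp z : a <= z <= b -> r z = p z by move=> /andP[_ zb]; rewrite /r zb.
have rq z : b <= z <= c -> r z = q z.
  move=> /andP[bz _]; rewrite /r; case: ifPn => // zb.
  by have -> : z = b; [apply/eqP; rewrite eq_le zb bz|].
exists r; split=> //.
have -> : `[a, c]%classic = `[a, b]%classic `|` `[b, c]%classic.
  apply/seteqP; split=> z; rewrite /= !in_itv /=.
    move=> /andP[az zc]; have [zb|/ltW bz] := leP z b; [left|right];
      by rewrite ?az ?bz.
  move=> [/andP[az zb]|/andP[bz zc]]; first by rewrite az (le_trans zb).
  by rewrite zc (le_trans ab).
apply: withinU_continuous; try exact: itv_closed.
- apply: subspace_eq_continuous cp => z.
  by rewrite inE /= in_itv /= => /rp.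
- apply: subspace_eq_continuous cq => z.
  by rewrite inE /= in_itv /= => /rq.
Qed.

(** Passage from local to global: by compactness [G] holds for all sufficiently close pairs, and
    transitivity chains N equal steps. *)
Lemma unit_interval_chain (G : R -> R -> Prop) :
  (forall a b c, I01 a -> I01 b -> I01 c -> a < b -> b < c ->
     G a b -> G b c -> G a c) ->
  (forall t, I01 t -> exists2 d, 0 < d &
     forall a b, I01 a -> I01 b -> a < b -> `|t - a| < d -> `|t - b| < d -> G a b) ->
  G 0 1.
Proof.
move=> Gtr Gloc.
have := (compact_near_coveringP _).1 (@compact_I01 R) R (0^'+) (fun d x => forall a b,
  I01 a -> I01 b -> a < b -> `|x - a| < d -> `|x - b| < d -> G a b) _.
case.
- move=> t /Gloc[d d0 H].
  exists (ball t (d / 2), [set e | e < d / 2]).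
    split; first by apply: nbhsx_ballx; rewrite divr_gt0.
    by near=> e => /=; near: e; apply: nbhs_right_lt; rewrite divr_gt0.
  move=> [z e] /= [tz ed] a b Ia Ib ab za zb.
  have tr c : `|z - c| < e -> `|t - c| < d.
    move=> zc; rewrite [d]splitr; apply: le_lt_trans (ler_distD z _ _) _.
    by apply: ltrD => //; exact: lt_trans ed.
  by apply: H => //; exact: tr.
- move=> e /= e0 H.
  have e2 : 0 < e / 2 by rewrite divr_gt0.
  have {}H a b : I01 a -> I01 b -> a < b -> b - a < e / 2 -> G a b.
    move=> Ia Ib ab abe; apply: (H (e / 2) _ e2 a) => //.
    + by rewrite /ball_/= sub0r normrN gtr0_norm// gtr_pMr// invf_lt1 ?ltr1n.
    + by rewrite subrr normr0.
    + by rewrite distrC gtr0_norm ?subr_gt0.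
  pose N := (Num.bound (e / 2)^-1).+1.
  have N0 : 0 < N%:R :> R by rewrite ltr0n.
  have Ne : N%:R^-1 < e / 2.
    rewrite invf_plt ?posrE//.
    apply: lt_le_trans (archi_boundP _) _; first by rewrite invr_ge0 ltW.
    by rewrite ler_nat.
  (* The induction starts at 1/N, since [G] is available for strictly increasing pairs. *)
  suff : forall k, (k < N)%N -> G 0 (k.+1%:R / N%:R).
    by move/(_ N.-1 (ltnSn _)); rewrite divff// gt_eqF.
  elim=> [|k IH] kN.
    apply: H; [by apply/I01P; rewrite lexx ler01|exact: frac_I01| |].
      by rewrite divr_gt0.
    by rewrite subr0 mul1r.
  have step : k.+2%:R / N%:R = k.+1%:R / N%:R + N%:R^-1 :> R.
    by rewrite -[k.+2%:R]natr1 mulrDl mul1r.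
  apply: (Gtr _ (k.+1%:R / N%:R)); last 1 first.
  + apply: H; [by apply: frac_I01 => //; exact: ltnW|exact: frac_I01| |];
      by rewrite step ?ltrDl ?invr_gt0// addrAC subrr add0r.
  + by apply/I01P; rewrite lexx ler01.
  + by apply: frac_I01 => //; exact: ltnW.
  + exact: frac_I01.
  + by rewrite divr_gt0 ?ltr0n.
  + by rewrite step ltrDl invr_gt0.
  + by apply: IH; exact: ltnW.
Unshelve. all: by end_near. Qed.

End Paths.

(** * Approximating a path in the disk by a path in the 1-skeleton *)

Section SkeletonPath.
Context {R : realType} (K : @triangulation R) (m : R) (gamma : R -> 'rV[R]_2).
Notation n := (tri_n K).
Implicit Types (s t : {set 'I_n}) (u v w : 'I_n).
Context (m_gt0 : 0 < m).
Context (cell_small : forall s, s \in tri_simplices K ->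
  forall x y, tri_cell s x -> tri_cell s y -> `|x - y| < m).
Context (gamma_continuous : {within I01, continuous gamma}).
Context (gamma_disk : forall z, I01 z -> disk (gamma z)).

Let vertex v : 'rV[R]_2 := @tri_map R K (delta_mx 0 v).

Lemma segment_face u v (c : R) : 0 <= c <= 1 ->
  std_face [set u; v]%SET ((1 - c) *: delta_mx 0 u + c *: delta_mx 0 v).
Proof.
move=> /andP[c0 c1].
have sd w : \sum_i (delta_mx 0 w : 'rV[R]_n) 0 i = 1.
  rewrite (bigD1 w)//= !mxE !eqxx big1 ?addr0// => i iw.
  by rewrite mxE eqxx (negbTE iw).
split; [|split].
- by move=> i; rewrite !mxE addr_ge0// mulr_ge0// ?subr_ge0// ler0n.
- transitivity (\sum_i ((1 - c) * (delta_mx 0 u : 'rV[R]_n) 0 i +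
      c * (delta_mx 0 v : 'rV[R]_n) 0 i)); first by apply: eq_bigr => i _; rewrite !mxE.
  by rewrite big_split /= -!mulr_sumr !sd !mulr1 subrK.
- move=> i; rewrite !inE negb_or => /andP[iu iv].
  by rewrite !mxE eqxx (negbTE iu) (negbTE iv) !mulr0 addr0.
Qed.

Lemma edge_path s u v (a b : R) : s \in tri_simplices K -> u \in s -> v \in s ->
  a < b -> exists p : R -> 'rV[R]_2, [/\ {within `[a, b], continuous p},
    p a = vertex u, p b = vertex v &
    forall z, a <= z <= b -> tri_skel1 K (p z) /\ tri_cell s (p z)].
Proof.
move=> sK us vs ab.
have ba : 0 < b - a by rewrite subr_gt0.
have uvs : [set u; v]%SET \subset s.
  by apply/fintype.subsetP => w; rewrite !inE => /orP[] /eqP ->.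
have uvK : [set u; v]%SET \in tri_simplices K.
  by apply: tri_faces sK uvs _; apply/set0Pn; exists u; rewrite !inE eqxx.
pose c (z : R) := (z - a) / (b - a).
pose e (z : R) : 'rV[R]_n := (1 - c z) *: delta_mx 0 u + c z *: delta_mx 0 v.
have cc : continuous c.
  move=> z; apply: cvgMr_tmp; apply: cvgB; [exact: cvg_id|exact: cvg_cst].
have ce : continuous e.
  move=> z; apply: cvgD; apply: cvgZr_tmp; last exact: cc.
  by apply: cvgB; [exact: cvg_cst|exact: cc].
have ef z : a <= z <= b -> std_face [set u; v]%SET (e z).
  move=> /andP[az zb]; apply: segment_face.
  by rewrite /c divr_ge0 ?subr_ge0// ?(ltW ab)//= ler_pdivrMr// mul1r lerB.
exists (@tri_map R K \o e); split.
- apply: (within_comp (B := std_face [set u; v]%SET) (f := e)).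
  + exact: continuous_subspaceT.
  + exact: tri_map_face_continuous.
  + by move=> z; rewrite /= in_itv /= => /ef.
- by rewrite /= /e /c subrr mul0r subr0 scale1r scale0r addr0.
- by rewrite /= /e /c divff ?gt_eqF// subrr scale0r scale1r add0r.
- move=> z /ef zf; split.
    exists [set u; v]%SET; last by exists (e z).
    by split=> //; rewrite cards2; case: (u != v).
  by exists (e z) => //; exact: std_faceS zf.
Qed.

(** The end vertices may be any vertices of any cells around [gamma a] and [gamma b]; this freedom
    lets two paths meet at a chosen vertex and gives transitivity. *)
Let linked (a b : R) := forall v w s t,
  s \in tri_simplices K -> t \in tri_simplices K -> v \in s -> w \in t ->
  tri_cell s (gamma a) -> tri_cell t (gamma b) ->
  exists p : R -> 'rV[R]_2, [/\ {within `[a, b], continuous p},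
    p a = vertex v, p b = vertex w &
    forall z, a <= z <= b -> tri_skel1 K (p z) /\ `|p z - gamma z| < 2 * m].

Let cell_vertex x : disk x -> exists s v, [/\ s \in tri_simplices K, v \in s & tri_cell s x].
Proof.
move=> dx; have [s sK sx] := disk_tri_cell K dx; have [y sy _] := sx.
by have [v vs _] := std_face_ex sy; exists s, v.
Qed.

Let linked_trans a b c : I01 a -> I01 b -> I01 c -> a < b -> b < c ->
  linked a b -> linked b c -> linked a c.
Proof.
move=> Ia Ib Ic ab bc Lab Lbc v w s t sK tK vs wt sa tc.
have [r [u [rK ur rb]]] := cell_vertex (gamma_disk Ib).
have [p [cp pa pb Hp]] := Lab v u s r sK rK vs ur sa rb.
have [q [cq qb qc Hq]] := Lbc u w r t rK tK ur wt rb tc.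
have abc : a <= b <= c by rewrite !ltW.
have [|l [cl lp lq]] := path_glue abc cp cq; first by rewrite pb.
exists l; split=> //.
- by rewrite lp// lexx ltW.
- by rewrite lq// lexx ltW.
- move=> z /andP[az zc]; have [zb|/ltW bz] := leP z b.
    by rewrite lp ?az//; apply: Hp; rewrite az.
  by rewrite lq ?bz//; apply: Hq; rewrite bz.
Qed.

(** All cells around both ends contain [x], so [s] and [t] share a vertex [u]: an edge of [s] leads
    to [u], an edge of [t] away from it. Both edges are within [m] of [x], and [x] is within [m] of
    [gamma]. *)
Let linked_near x a b : a < b ->
  (forall s, s \in tri_simplices K -> tri_cell s (gamma a) -> tri_cell s x) ->
  (forall s, s \in tri_simplices K -> tri_cell s (gamma b) -> tri_cell s x) ->
  (forall z, a <= z <= b -> `|x - gamma z| < m) -> linked a b.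
Proof.
move=> ab Ha Hb Hz v w s t sK tK vs wt /(Ha _ sK) sx /(Hb _ tK) tx.
have [y /std_face_ex[u + _] _] := tri_cellI sK tK sx tx.
rewrite finset.in_setI => /andP[us ut].
pose c := (a + b) / 2.
have [ac cb] : a < c /\ c < b by rewrite midf_lt// /c; split; lra.
have [p [cp pa pb Hp]] := edge_path sK vs us ac.
have [q [cq qb qc Hq]] := edge_path tK ut wt cb.
have acb : a <= c <= b by rewrite !ltW.
have [|l [cl lp lq]] := path_glue acb cp cq; first by rewrite pb.
exists l; split=> //.
- by rewrite lp// lexx ltW.
- by rewrite lq// lexx ltW.
- have tri z y' : a <= z <= b -> `|y' - x| < m -> `|y' - gamma z| < 2 * m.
    move=> zab yx; rewrite mulr_natl mulr2n; apply: le_lt_trans (ler_distD x _ _) _.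
    by apply: ltrD => //; exact: Hz.
  move=> z zab; have /andP[az zb] := zab; have [zc|/ltW cz] := leP z c.
    rewrite lp ?az//; have [|h1 h2] := Hp z; first by rewrite az.
    by split=> //; apply: tri => //; exact: (cell_small sK).
  rewrite lq ?cz//; have [|h1 h2] := Hq z; first by rewrite cz.
  by split=> //; apply: tri => //; exact: (cell_small tK).
Qed.

Lemma tri_cell_closed s : s \in tri_simplices K -> closed (tri_cell s).
Proof.
move=> sK; apply: compact_closed; first exact: norm_hausdorff.
apply: continuous_compact; first exact: tri_map_face_continuous.
apply: bounded_closed_compact.
  exists 1; split=> // r r1 y [y0 [y1 _]]; apply: row_norm_le => [|i].
    by apply: ltW; exact: lt_trans r1.
  rewrite ger0_norm//; apply: le_trans (ltW r1); rewrite -y1 (bigD1 i)//= lerDl.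
  by apply: sumr_ge0 => j _.
(* The vanishing of the weights outside [s] is written as an equation with a factor 0 or 1, which is
   a closed condition. *)
have -> : std_face s = [set y : 'rV[R]_n | \sum_i y 0 i = 1] `&`
    \bigcap_(i in [set: 'I_n]) ([set y | 0 <= y 0 i] `&`
      [set y | (i \notin s)%:R * y 0 i = 0]).
  apply/seteqP; split=> [y [y0 [y1 ys]]|y [y1 H]].
    split=> // i _; split=> //=; case: (boolP (i \in s)) => [_|/ys ->].
      by rewrite mul0r.
    by rewrite mulr0.
  split; [|split] => //= i; have [//= _ yi] := H i I.
  by move=> si; rewrite si mul1r in yi.
have pc (h : 'rV[R]_n -> R) (D : set R) : continuous h -> closed D -> closed (h @^-1` D).
  by move=> ch cD; apply: preimage_closed => // y _; exact: ch.
apply: closedI.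
  apply: (pc (fun y => \sum_i y 0 i) [set x | x = 1]); last exact: closed_eq.
  by apply: continuous_sumr => i; exact: coord_continuous.
apply: closed_bigI => i _; apply: closedI.
  apply: (pc (fun y => y 0 i) [set x | 0 <= x]); last exact: closed_ge.
  exact: coord_continuous.
apply: (pc (fun y => (i \notin s)%:R * y 0 i) [set x | x = 0]); last exact: closed_eq.
have cM (T : topologicalType) (c : R) (g : T -> R) : continuous g ->
    continuous (fun z => c * g z).
  by move=> cg z; apply: cvgMl_tmp; exact: cg.
by apply: cM; exact: coord_continuous.
Qed.

(** The finitely many cells that miss [gamma z0] are closed, so near [z0] the path meets only cells
    containing [gamma z0], which serves as the point [x] of [linked_near]. *)
Let linked_local (z0 : R) : I01 z0 -> exists2 d, 0 < d &
  forall a b, I01 a -> I01 b -> a < b -> `|z0 - a| < d -> `|z0 - b| < d -> linked a b.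
Proof.
move=> It.
have cg := (subspace_continuousP _ _).1 gamma_continuous z0 It.
have H1 (s : {set 'I_n}) : \forall z \near within I01 (nbhs z0),
    s \in tri_simplices K -> tri_cell s (gamma z) -> tri_cell s (gamma z0).
  have [[sK /= st]|H] := pselect (s \in tri_simplices K /\ ~ tri_cell s (gamma z0)).
    have : nbhs (gamma z0) (~` tri_cell s).
      by apply: open_nbhs_nbhs; split => //; apply: closed_openC; exact: tri_cell_closed.
    move=> /cg h; have : within I01 (nbhs z0) [set z | ~ tri_cell s (gamma z)] by exact: h.
    by apply: filterS => z /= nz _ /nz.
  by near=> z => sK _; apply: contrapT => st; exact: (H (conj sK st)).
have H2 : \forall z \near within I01 (nbhs z0), `|gamma z0 - gamma z| < m.
  have : nbhs (gamma z0) (ball (gamma z0) m) by exact: nbhsx_ballx.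
  move=> /cg h; have : within I01 (nbhs z0) (gamma @^-1` ball (gamma z0) m) by exact: h.
  by apply: filterS => z /=; rewrite mx_norm_ball.
have H3 := filter_forall _ H1.
have : within I01 (nbhs z0) [set z | `|gamma z0 - gamma z| < m /\
    forall s, s \in tri_simplices K -> tri_cell s (gamma z) -> tri_cell s (gamma z0)].
  exact: filterI H2 (H3 _).
move=> /nbhs_ballP[d /= d0 Hd]; exists d => // a b Ia Ib ab ta tb.
apply: (linked_near (x := gamma z0)) => //.
- by move=> s; apply: (Hd a ta Ia).2.
- by move=> s; apply: (Hd b tb Ib).2.
- move=> z /andP[az zb].
  have Iz : I01 z.
    move: Ia Ib => /I01P/andP[a0 _] /I01P/andP[_ b1]; apply/I01P.
    by rewrite (le_trans a0)//= (le_trans zb).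
  apply: (Hd z _ Iz).1; rewrite /ball /=.
  move: ta tb; rewrite !ltr_norml !ltrBlDr => /andP[? ?] /andP[? ?]; apply/andP; split; lra.
Unshelve. all: by end_near. Qed.

Lemma skeleton_path : exists p : R -> 'rV[R]_2, {within I01, continuous p} /\
  forall z, I01 z -> tri_skel1 K (p z) /\ `|p z - gamma z| < 2 * m.
Proof.
have L : linked 0 1 := unit_interval_chain linked_trans linked_local.
have I0 : I01 (0 : R) by apply/I01P; rewrite lexx ler01.
have I1 : I01 (1 : R) by apply/I01P; rewrite lexx ler01.
have [s [v [sK vs s0]]] := cell_vertex (gamma_disk I0).
have [t [w [tK wt t1]]] := cell_vertex (gamma_disk I1).
have [p [cp _ _ Hp]] := L v w s t sK tK vs wt s0 t1.
by exists p; split=> // z /I01P; exact: Hp.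
Qed.

End SkeletonPath.

(** * Arcs near the boundary of the disk *)

Section DiskArc.
Context {R : realType}.
Implicit Types x y : 'rV[R]_2.

Lemma interior_disk_lt1 x : interior disk x -> enorm x < 1.
Proof.
move=> /nbhs_ballP[r /= r0 xr]; have [enZ norm_le] := (@gauge_like_enorm R 2).2.
rewrite ltNge; apply/negP => x1.
have n0 : 0 < `|x| + 1 by rewrite ltr_wpDl.
(* Stretching by 1 + d moves [x] by less than [r] but out of the disk; the summand 1 keeps the
   denominator positive. *)
pose d := r / (2 * (`|x| + 1)).
have d0 : 0 < d by rewrite divr_gt0// mulr_gt0.
have : disk ((1 + d) *: x).
  apply: xr; rewrite mx_norm_ball /ball_ /= scalerDl scale1r opprD addrA subrr add0r normrN normrZ gtr0_norm//.
  rewrite /d mulrAC ltr_pdivrMr ?mulr_gt0// ltr_pM2l//.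
  by rewrite mulrDr mulr1 (@le_lt_trans _ _ (2 * `|x|)) ?ltrDl// ler_peMl// ler1n.
rewrite /disk /eball /= enZ ?addr_ge0 ?(ltW d0)//; apply/negP; rewrite -ltNge.
by apply: (@lt_le_trans _ _ (1 + d)); rewrite ?ltrDl// ler_peMr// addr_ge0// ltW.
Qed.

Lemma disk_compact : compact (@disk R).
Proof.
have [ce [_ norm_le]] := @gauge_like_enorm R 2.
apply: bounded_closed_compact.
  by exists 1; split=> // r r1 x x1; apply: le_trans (norm_le x) (le_trans x1 (ltW r1)).
apply: (@preimage_closed _ _ (@enorm R 2) [set r | r <= 1]); last exact: closed_le.
by move=> x _; exact: ce.
Qed.

Lemma continuous_sqrtr (T : topologicalType) (g : T -> R) :
  continuous g -> continuous (fun z => Num.sqrt (g z)).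
Proof. by move=> cg z; exact: (cvg_comp _ _ (cg z) (@sqrt_continuous R _)). Qed.

(** The upper right quarter of the unit circle is parametrised by its first coordinate, so a
    function of that coordinate reads off [s] at [arc s]. *)
Definition arc (s : R) : 'rV[R]_2 := \row_i (if i == 0 then s else Num.sqrt (1 - s ^+ 2)).

Lemma arc_continuous : continuous arc.
Proof.
have -> : arc = fun s => s *: delta_mx 0 0 + Num.sqrt (1 - s ^+ 2) *: delta_mx 0 1.
  apply/funext => s; apply/rowP => i; rewrite !mxE eqxx /=.
  by case: i => -[|[|//]] /= ?; rewrite ?mulr1 ?mulr0 ?addr0 ?add0r.
have cq : continuous (fun s : R => Num.sqrt (1 - s ^+ 2)).
  apply: continuous_sqrtr => z.
  by apply: cvgB; [exact: cvg_cst|exact: exprn_continuous].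
by move=> s; apply: cvgD; apply: cvgZr_tmp; [exact: cvg_id|exact: cq].
Qed.

Lemma enorm_arc s : I01 s -> enorm (arc s) = 1.
Proof.
move=> /I01P/andP[s0 s1]; rewrite /enorm big_ord_recl big_ord1 !mxE /=.
by rewrite sqr_sqrtr ?subr_ge0 ?expr_le1// addrC subrK sqrtr1.
Qed.

Lemma coord_arc_le1 s i : I01 s -> `|arc s 0 i| <= 1.
Proof. by move=> /enorm_arc <-; exact: coord_le_enorm. Qed.

Lemma enorm_scale_arc (c : R) s : 0 <= c -> I01 s -> enorm (c *: arc s) = c.
Proof. by move=> c0 Is; rewrite (@gauge_like_enorm R 2).2.1// enorm_arc// mulr1. Qed.

Lemma coord_norm_lt x y (r : R) : `|x - y| < r -> forall i, `|x 0 i - y 0 i| < r.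
Proof.
move=> xy i; apply: le_lt_trans xy; have := coord_le_norm (x - y) i.
by rewrite !mxE.
Qed.

(** The squared radii differ by 1 - (1 - 8r)^2 = 16r - 64r^2, more than 8r. A common nearby point
    would let the squares differ by at most 4r in each coordinate. *)
Lemma concentric_arcs_disjoint x (r : R) s t : 0 < r -> 8 * r < 1 -> I01 s -> I01 t ->
  `|x - arc s| < r -> `|x - (1 - 8 * r) *: arc t| < r -> False.
Proof.
move=> r0 r8 Is It /coord_norm_lt xs /coord_norm_lt xt.
have rho0 : 0 <= 1 - 8 * r by rewrite subr_ge0 ltW.
have H i : arc s 0 i ^+ 2 - ((1 - 8 * r) *: arc t) 0 i ^+ 2 <= 4 * r.
  have a1 := coord_arc_le1 i Is.
  have b1 : `|((1 - 8 * r) *: arc t) 0 i| <= 1.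
    by rewrite (le_trans (coord_le_enorm _ _))// enorm_scale_arc// lerBlDr lerDl mulr_ge0// ltW.
  move: (xs i) (xt i) a1 b1; move: (x 0 i) (arc s 0 i) (((1 - 8 * r) *: arc t) 0 i) => a b c.
  rewrite !ltr_norml !ler_norml !ltrBlDr => /andP[? ?] /andP[? ?] /andP[? ?] /andP[? ?].
  rewrite subr_sqr.
  have : `|b - c| <= 2 * r by rewrite ler_norml; apply/andP; split; lra.
  have : `|b + c| <= 2 by rewrite ler_norml; apply/andP; split; lra.
  move=> h1 h2; apply: le_trans (ler_norm _) _; rewrite normrM.
  rewrite (_ : 4 * r = (2 * r) * 2); last by ring.
  by apply: ler_pM.
have e1 := sqr_enorm (arc s); rewrite enorm_arc// big_ord_recl big_ord1 in e1.
have e2 := sqr_enorm ((1 - 8 * r) *: arc t).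
rewrite enorm_scale_arc// big_ord_recl big_ord1 in e2.
have h0 := H 0; have h1 := H (lift ord0 ord0); nra.
Qed.

(** The mesh is measured by Euclidean distance, which dominates the sup norm used in the
    conclusion. *)
Lemma mesh_small (K : nat -> @triangulation R) (r : R) : 0 < r ->
  mesh (K i) @[i --> \oo] --> 0%E ->
  exists i, forall s, s \in tri_simplices (K i) ->
    forall x y, tri_cell s x -> tri_cell s y -> `|x - y| < r.
Proof.
move=> r0 mK.
have : nbhs (0 : \bar R)%E [set x | (x < r%:E)%E].
  apply: open_nbhs_nbhs; split; last by rewrite /= lte_fin.
  exact: open_ereal_lt_ereal.
move=> /mK; rewrite /= nbhs_simpl /=.
move=> [i _ Hi]; exists i => s sK x y sx sy.
apply: le_lt_trans ((@gauge_like_enorm R 2).2.2 _) _.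
rewrite -lte_fin; apply: le_lt_trans (Hi i (leqnn i)).
apply: (@le_trans _ _ (diam (@eucl_dist R 2) (tri_cell s))).
  by apply: ereal_sup_ubound; exists x, y.
by apply: ereal_sup_ubound; exists s.
Qed.

End DiskArc.

(** * Clipping to the unit interval and convexity of the disk *)

Section Stitched.
Context {R : realType}.

Lemma clip_I01 (z : R) : I01 (Num.max 0 (Num.min 1 z)).
Proof. by apply/I01P; rewrite le_max lexx ge_max ler01 ge_min lexx. Qed.

Lemma clip_dist (s z r : R) : I01 s -> `|z - s| < r -> `|s - Num.max 0 (Num.min 1 z)| < r.
Proof.
move=> /I01P/andP[s0 s1]; rewrite !ltr_norml => /andP[h1 h2].
have [z1|z1] := leP 1 z; have [z0|z0] := leP 0 z; rewrite ?(max_r ler01)//; lra.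
Qed.

Lemma clip_continuous : continuous (fun z : R => Num.max 0 (Num.min 1 z)).
Proof.
apply: max_fun_continuous; first exact: cst_continuous.
by apply: min_fun_continuous; [exact: cst_continuous|by move=> ?; exact: cvg_id].
Qed.

Lemma tri_skel1_disk (K : @triangulation R) : tri_skel1 K `<=` disk.
Proof. by move=> x [s [/= sK _]]; exact: tri_cell_disk. Qed.

(** The squared norm of the combination is (1 - t)|x|^2 + t|y|^2 - t(1 - t)|x - y|^2. *)
Lemma disk_convex (x y : 'rV[R]_2) (t : R) : I01 t -> disk x -> disk y ->
  disk ((1 - t) *: x + t *: y).
Proof.
rewrite /disk /eball /= => /I01P/andP[t0 t1] x1 y1.
rewrite -(ler_pXn2r (ltn0Sn 1)) ?nnegrE ?enorm_ge0// expr1n.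
have := sqr_enorm x; have := sqr_enorm y; rewrite (sqr_enorm (_ + _)).
rewrite !big_ord_recl !big_ord0 !mxE !addr0.
have := exprn_ile1 2 (enorm_ge0 x) x1; have := exprn_ile1 2 (enorm_ge0 y) y1.
move: (enorm x ^+ 2) (enorm y ^+ 2) (x _ _) (x _ _) (y _ _) (y _ _).
move=> p q a b c d q1 p1 e1 e2.
have h1 := sqr_ge0 (a - c); have h2 := sqr_ge0 (b - d).
have h3 : 0 <= t * (1 - t) * ((a - c) ^+ 2 + (b - d) ^+ 2).
  by rewrite mulr_ge0 ?addr_ge0// mulr_ge0// subr_ge0.
have h4 : (1 - t) * p <= 1 - t by rewrite ler_piMr// subr_ge0.
have h5 : t * q <= t by rewrite ler_piMr.
rewrite e1 e2 in h4 h5; nra.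
Qed.

End Stitched.

(** * From stitched disks to the piecewise disjoint arc-disk property *)

Theorem theorem5p9 (R : realType) (X : metricType R)
  (hdim : finite_dimensional X) (hANR : ANR X)
  (hstitched : closed_0_stitched_disks X) : P_DADP X.
Proof.
move=> f alpha eps cf calpha eps0.
(* Near the arc [g'] will be within 2k of [alpha], so tracks have diameter at most 4k, strictly
   below [eps]. *)
pose k := eps / 8.
have k0 : 0 < k by rewrite divr_gt0.
have [w w0 Hw] := compact_unif_continuous (@compact_I01 R) calpha k0.
pose clip (z : R) := Num.max 0 (Num.min 1 z).
pose g (x : 'rV[R]_2) := alpha (clip (x 0 0)).
have cg : {within disk, continuous g}.
  apply: (within_comp (f := fun x : 'rV[R]_2 => clip (x 0 0)) _ calpha).
    apply: continuous_subspaceT => x.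
    by apply: continuous_comp; [exact: coord_continuous|exact: clip_continuous].
  by move=> x _; exact: clip_I01.
have [f' [g' [A [B [S1 [S2 [cf' [cg' [af [ag [_ [_ [_ [cB [_ [iB
  [[K1 [_ [mK1 ES1]]] [[K2 [_ [mK2 ES2]]] [fg0 [AS [BS inj]]]]]]]]]]]]]]]]]]]]] :=
  hstitched f g cf cg k k0.
(* All points of the second disk used below lie within 16r of the arc: there [B] is absent and the
   oscillation of [alpha] is below k. *)
have [r [r0 r8 rw arcB]] : exists r, [/\ 0 < r, 16 * r < 1, 16 * r < w &
    forall s y, I01 s -> B y -> ~ `|arc s - y| < 16 * r].
  have [|||d d0 Hd] := @compact_gap R _ (@arc R @` I01) B.
  - apply: continuous_compact; last exact: compact_I01.
    by apply: continuous_subspaceT; exact: arc_continuous.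
  - exact: cB.
  - apply/seteqP; split=> // _ [[s Is <-] /iB/interior_disk_lt1].
    by rewrite enorm_arc// ltxx.
  (* Dividing by 17 makes 16r strictly smaller than each of 1, [w] and [d]. *)
  exists (Num.min (Num.min 1 w) d / 17).
  set q := Num.min _ d.
  have q0 : 0 < q by rewrite !lt_min ltr01 w0 d0.
  have [q1 qw qd] : [/\ q <= 1, q <= w & q <= d] by rewrite !ge_min !lexx !orbT.
  split; [by rewrite divr_gt0|lra|lra|] => s y Is By sy.
  apply: (Hd (arc s) y) => //.
  by rewrite mx_norm_ball /ball_ /=; apply: lt_le_trans qd; lra.
(* [skeleton_path] doubles the cell size, so cells of size r/2 give paths within r. *)
have r2 : 0 < r / 2 by rewrite divr_gt0.
have [j Hj] := mesh_small r2 mK2.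
have in_disk (c s : R) : 0 <= c <= 1 -> I01 s -> disk (c *: arc s).
  by move=> /andP[c0 c1] Is; rewrite /disk /eball /= enorm_scale_arc.
have path c : 0 <= c <= 1 -> exists p : R -> 'rV[R]_2, {within I01, continuous p} /\
    forall s, I01 s -> S2 (p s) /\ `|p s - c *: arc s| < r.
  move=> c01; have [||p [cp Hp]] := skeleton_path (gamma := fun s => c *: arc s) r2 Hj.
  - apply: continuous_subspaceT => s; apply: cvgZl_tmp; exact: arc_continuous.
  - by move=> s; exact: in_disk.
  exists p; split=> // s Is; have [h1 h2] := Hp s Is; split.
    by rewrite ES2; exists j.
  by rewrite mulrC divfK// in h2.
have [|J1 [cJ1 HJ1]] := path 1; first by rewrite ler01 lexx.
(* Radius 1 - 8r is far enough from 1 to separate the two paths, yet keeps [J2] within 9r of the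
   arc. *)
have rho01 : 0 <= 1 - 8 * r <= 1 by lra.
have [J2 [cJ2 HJ2]] := path (1 - 8 * r) rho01.
have S2disk x : S2 x -> disk x by rewrite ES2 => -[i _]; exact: tri_skel1_disk.
have S2B x : S2 x -> ~ B x by move=> Sx Bx; rewrite -[False]/(set0 x) -BS.
pose near_arc (J : R -> 'rV[R]_2) := [/\ {within I01, continuous J},
  (forall s, I01 s -> S2 (J s)) & forall s, I01 s -> `|J s - arc s| < 16 * r].
have nJ1 : near_arc J1.
  split=> // s Is; have [// h1 h2] := HJ1 s Is.
  by rewrite scale1r in h2; apply: lt_le_trans h2 _; lra.
have nJ2 : near_arc J2.
  split=> // s Is; have [// h1 h2] := HJ2 s Is.
  apply: le_lt_trans (ler_distD ((1 - 8 * r) *: arc s) _ _) _.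
  have : `|(1 - 8 * r) *: arc s - arc s| <= 8 * r.
    rewrite scalerBl scale1r addrAC subrr sub0r normrN normrZ gtr0_norm ?mulr_gt0//.
    rewrite ler_piMr ?mulr_ge0 ?(ltW r0)// -(enorm_arc Is).
    exact: (@gauge_like_enorm R 2).2.2.
  lra.
have J12 s t : I01 s -> I01 t -> J1 s <> J2 t.
  move=> Is It e; have [_ h1] := HJ1 s Is; have [_ h2] := HJ2 t It.
  rewrite scale1r in h1; rewrite -e in h2.
  by apply: (concentric_arcs_disjoint r0 _ Is It h1 h2); lra.
have cgJ J : near_arc J -> {within I01, continuous (g' \o J)}.
  by move=> [cJ SJ _]; apply: (within_comp cJ cg') => s /SJ /S2disk.
have [|||d d0 Hd] := @compact_gap R _ ((g' \o J1) @` I01) ((g' \o J2) @` I01).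
- exact: continuous_compact (cgJ _ nJ1) (@compact_I01 R).
- apply: compact_closed; first exact: metric_hausdorff.
  exact: continuous_compact (cgJ _ nJ2) (@compact_I01 R).
- apply/seteqP; split=> // _ [[s Is <-] [t It /= e]].
  have [S1s _] := HJ1 s Is; have [S2t _] := HJ2 t It.
  have := inj (inr (J1 s)) (inr (J2 t)) (mem_set S1s) (mem_set S2t) (esym e).
  by move=> [/(J12 s t Is It)].
(* The triangulation of the first disk is chosen only now, so that points of one cell have images
   under [f'] closer than the gap [d]. *)
have [e e0 He] := compact_unif_continuous (@disk_compact R) cf' d0.
have [i Hi] := mesh_small e0 mK1.
have [T [skelT cellT]] := triangulation_cell_complex (K1 i).
have miss x y : disk x -> ~ B x -> cc_skel1 T y -> g' x <> f' y.
  move=> Dx Bx /skelT Ty gf; rewrite -[False]/(set0 (f' y)) -fg0; split.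
    exists y => //; split; first exact: tri_skel1_disk Ty.
    by move=> Ay; rewrite -[False]/(set0 y) -AS; split=> //; rewrite ES1; exists i.
  by exists x.
have close x s : disk x -> I01 s -> `|x - arc s| < 16 * r ->
    mdist (alpha s) (g' x) < 2 * k.
  move=> Dx Is xs; apply: le_lt_trans (metric_triangle _ (g x) _) _.
  rewrite mulr_natl mulr2n; apply: ltrD; last exact: ag.
  have := Hw s (clip (x 0 0)) Is (clip_I01 _); rewrite ballEmdist; apply.
  rewrite /ball /=; apply: clip_dist => //.
  have := coord_norm_lt xs 0; rewrite mxE eqxx => h; exact: lt_trans rw.
exists T, f', (g' \o J1).
split; first exact: cf'.
split; first exact: cgJ.
split; first by move=> x Dx; apply: lt_le_trans (af x Dx) _; rewrite /k; lra.
split.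
  move=> s Is; have [_ /(_ s Is) Ss /(_ s Is) h] := nJ1.
  by apply: lt_le_trans (close _ _ (S2disk _ Ss) Is h) _; rewrite /k; lra.
split.
  move=> _ [s Is <-] [y Ty fy]; have [_ /(_ s Is) Ss _] := nJ1.
  exact: (miss (J1 s) y (S2disk _ Ss) (S2B _ Ss) Ty (esym fy)).
move=> sigma /cellT[s sK ->].
have [J nJ Jmiss] : exists2 J, near_arc J &
    forall t, I01 t -> ~ (f' @` tri_cell s) (g' (J t)).
  have [H|H] := pselect (forall t, I01 t -> ~ (f' @` tri_cell s) (g' (J1 t))).
    by exists J1.
  exists J2 => // t It [y sy fy]; apply: H => t' It' [y' sy' fy'].
  apply: (Hd (g' (J1 t')) (g' (J2 t))); [by exists t'|by exists t|].
  rewrite -fy -fy'; apply: He; [exact: tri_cell_disk sy'|exact: tri_cell_disk sy|].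
  by rewrite mx_norm_ball /ball_ /=; exact: (Hi s sK).
(* Both end paths stay within 16r of the arc, hence so do the segments between them, and [arcB]
   keeps these off [B]. For [J] equal to [J1] the homotopy is stationary. *)
pose M (p : R * R) : 'rV[R]_2 := (1 - p.2) *: J1 p.1 + p.2 *: J p.1.
have [cJ SJ aJ] := nJ; have [_ SJ1 aJ1] := nJ1.
have Mdisk p : (I01 `*` I01) p -> disk (M p).
  by move=> [I1 I2]; apply: disk_convex => //; apply: S2disk; [exact: SJ1|exact: SJ].
have Marc p : (I01 `*` I01) p -> `|M p - arc p.1| < 16 * r.
  move=> [I1 /= /I01P/andP[t0 t1]].
  have -> : M p - arc p.1 = (1 - p.2) *: (J1 p.1 - arc p.1) + p.2 *: (J p.1 - arc p.1).
    by rewrite !scalerBr addrACA -opprD -scalerDl subrK scale1r.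
  apply: le_lt_trans (ler_normD _ _) _; rewrite !normrZ !ger0_norm ?subr_ge0//.
  have h1 := aJ1 _ I1; have h2 := aJ _ I1.
  move: (`|J1 p.1 - _|) (`|J p.1 - _|) h1 h2 => a b h1 h2.
  apply: (@le_lt_trans _ _ (Num.max a b)); last by rewrite gt_max h1.
  have am : 0 <= (1 - p.2) * (Num.max a b - a).
    by apply: mulr_ge0; rewrite subr_ge0// le_max lexx.
  have bm : 0 <= p.2 * (Num.max a b - b).
    by apply: mulr_ge0; rewrite ?subr_ge0// le_max lexx orbT.
  lra.
exists (g' \o M), (g' \o J); split; last split.
- split; last split.
  + apply: (within_comp _ cg' Mdisk); apply/subspace_continuousP => p Ip.
    have cfst h : {within I01, continuous h} ->
        {within I01 `*` I01, continuous (fun p : R * R => h p.1 : 'rV[R]_2)}.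
      move=> ch; apply: (within_comp (f := fun p : R * R => p.1) _ ch).
        by apply: continuous_subspaceT => q; exact: cvg_fst.
      by move=> q [].
    have c1 := (subspace_continuousP _ _).1 (cfst _ cJ1) p Ip.
    have c2 := (subspace_continuousP _ _).1 (cfst _ cJ) p Ip.
    have c3 : (fun q : R * R => q.2) x @[x --> within (I01 `*` I01) (nbhs p)] --> p.2.
      by apply: cvg_within_filter; exact: cvg_snd.
    apply: cvgD; apply: cvgZ => //.
    by apply: cvgB => //; exact: cvg_cst.
  + move=> z t Iz It [y Ty fy]; apply: (miss (M (z, t)) y) => //; first exact: Mdisk.
    by move=> /(arcB z _ Iz); apply; rewrite distrC; exact: (Marc (z, t) (conj Iz It)).
  + move=> z Iz; rewrite /M /= subrr subr0 !scale0r !scale1r addr0 add0r.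
    by split.
- move=> z Iz.
  have bound p : (I01 `*` I01) p -> p.1 = z -> mdist (alpha z) (g' (M p)) < 2 * k.
    move=> Ip pz; apply: close => //; first exact: Mdisk.
    by rewrite -pz; exact: Marc.
  (* A supremum of strict bounds need not be strict; the slack between 4k and eps = 8k restores
     strictness. *)
  apply: (@le_lt_trans _ _ (4 * k)%:E); last by rewrite lte_fin /k; lra.
  apply: ub_ereal_sup => _ [x [y [[p [pz pI] <-] [[q [qz qI] <-] ->]]]].
  rewrite lee_fin; apply: le_trans (metric_triangle _ (alpha z) _) _.
  have h1 : mdist (alpha z) (g' (M p)) < 2 * k by apply: bound => //; split=> //; rewrite pz.
  have h2 : mdist (alpha z) (g' (M q)) < 2 * k by apply: bound => //; split=> //; rewrite qz.
  by rewrite metric_sym /=; lra.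
- by move=> _ [t It <-]; exact: Jmiss.
Qed.
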